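(* Let $A$ be a Frobenius algebra over $k=\mathbb Z$, let $\Delta_{CH}$ be the degree $1$ coproduct on $CH^*(A,A)$, and let $\Delta_{sym}:=\Delta_{CH}+\Delta_{CH}^{op}$. Then $\Delta_{sym}$ is also a well defined (co)homology operation. It is null-homotopic modulo $CH^0(A)$; if $A$ is graded Gorenstein, it is null-homotopic modulo the constants in $CH^0(A)$. Thus the coproduct is cocommutative modulo $CH^0(A)$, and it is cocommutative in $\widetilde{CH}^*(A)$ if $A$ is graded Gorenstein.
   Context: A Frobenius algebra $A$ is an associative, unital (possibly $\mathbb Z/2\mathbb Z$-graded) $k$-algebra with an even, symmetric, perfect pairing satisfying $\langle a,bc\rangle=\langle ab,c\rangle$; $\epsilon(a)=\langle 1,a\rangle$. The coproduct $\Delta:A\to A\otimes A$ is defined by $\langle\Delta(a),b\otimes c\rangle=\langle a,bc\rangle$, where $\langle a\otimes b,c\otimes d\rangle=\langle a,c\rangle\langle b,d\rangle$; $C=\Delta(1)=\sum C^{(1)}\otimes C^{(2)}$ is the Casimir element and $C_1,C_2$ denote independent copies of it. $A$ is graded Gorenstein with socle $d$ if $A=\bigoplus_{i=0}^dA_i$ is graded with $A_0=k\cdot1$, the top degree part $A_d$ is spanned by the unique degree $d$ element $e_{top}$ with $\epsilon(e_{top})=1$, and the pairing pairs $A_i$ with $A_{d-i}$; put $\bar A=\bigoplus_{i>0}A_i$. $CH^n(A,M)=\mathrm{Hom}(A^{\otimes n},M)$ is the Hochschild cochain complex. The Frobenius pairing identifies $CH^*(A,A)$ with $CH^*(A):=CH^*(A,\check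 A)$, $\check A$ the dual of $A$. The reduced Hochschild chain complex has $\widetilde{CH}_n(A)=A\otimes\bar A^{\otimes n}$ for $n>0$ and $\widetilde{CH}_0(A)=\bar A$. The reduced complex $\widetilde{CH}^*(A)$ is its dual; it is also the normalized complex (cochains vanishing whenever an argument is $1$) modulo the constants in $\overline{CH}^0(A)$ (the functionals on $A$ dual to $A_0$). The coproduct $\Delta_{CH}:CH^*(A,A)\to CH^*(A,A)^{\otimes2}$ has, for $f\in CH^n(A,A)$, the components in $CH^p\otimes CH^q$, $p+q=n-1$, given (up to Koszul signs from a grading of $A$) by $$\Delta_{CH}(f)[(a_1\otimes\cdots\otimes a_p)\otimes(a_{p+1}\otimes\cdots\otimes a_{n-1})]=(-1)^p\sum C_1^{(1)}f(a_1\otimes\cdots\otimes a_p\otimes C_2^{(1)}C_1^{(2)}\otimes a_{p+1}\otimes\cdots\otimes a_{n-1})\otimes C_2^{(2)}.$$ $\Delta_{CH}^{op}$ is $\Delta_{CH}$ followed by the (signed) interchange of the two output factors; with the shifted-degree sign conventions used for the Gerstenhaber bracket, $\Delta_{sym}$ is the anti-symmetrization of $\Delta_{CH}$, and cocommutativity is understood up to homotopy and in this signed sense. An operation is a well defined cohomology operation if its graded commutator with the Hochschild differentials vanishes. ''Modulo $CH^0(A)$'' (or modulo constants) means after passing to the quotient by $CH^0(A)$ (or by the constants) in the output factors.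
   Formalization: The displayed coproduct formula fails for noncommutative A (e.g. 2×2 integer matrices), so both products in it are taken in the opposite order, f(… C_1^(2)C_2^(1) …)C_1^(1) ⊗ C_2^(2); for graded commutative A this equals the displayed formula. *)

(* Defs.v *)
From HB Require Import structures.
From mathcomp Require Import all_boot all_order all_algebra.
From mathcomp Require Import ring.

Set Implicit Arguments.
Unset Strict Implicit.
Unset Printing Implicit Defensive.

Import GRing.Theory.
Local Open Scope ring_scope.

(** Frobenius algebras over Z.  A Casimir element in A (x) A
    exists only if the underlying Z-module is finitely generated, hence free,
    and then so are its even and odd parts; the Z/2-grading is recorded as the
    parity of a homogeneous basis ([fun=> false] in the ungraded case).  The
    algebra need not be commutative.  The field [frob_perfect] says that
    a |-> <a, -> is a bijection from A onto its dual Hom(A, Z). *)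
Record frobeniusAlgebra := FrobeniusAlgebra {
  frob_ring :> pzRingType;
  rk : nat;
  bas : 'I_rk -> frob_ring;
  coord : frob_ring -> 'rV[int]_rk;
  par : 'I_rk -> bool;
  pairing : frob_ring -> frob_ring -> int;
  coordK : forall a, \sum_i bas i *~ coord a 0 i = a;
  basK : forall c : 'rV[int]_rk, coord (\sum_i bas i *~ c 0 i) = c;
  par_mul : forall i j k,
    coord (bas i * bas j) 0 k != 0 -> par k = par i (+) par j;
  par_one : forall k, coord 1 0 k != 0 -> par k = false;
  pairingDl : forall a b c, pairing (a + b) c = pairing a c + pairing b c;
  pairingDr : forall a b c, pairing a (b + c) = pairing a b + pairing a c;
  pairing_even : forall i j, pairing (bas i) (bas j) != 0 -> par i = par j;
  pairing_sym : forall i j,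
    pairing (bas i) (bas j) = (-1) ^+ (par i && par j) * pairing (bas j) (bas i);
  pairing_assoc : forall a b c, pairing a (b * c) = pairing (a * b) c;
  frob_perfect : forall l : {additive frob_ring -> int},
    exists! a, forall b, pairing a b = l b
}.

Section Frobenius.
Variable A : frobeniusAlgebra.

Definition counit (a : A) : int := pairing 1 a.

(** Z-linear extension of a function given on the basis. *)
Definition linext (V : zmodType) (g : 'I_(rk A) -> V) (a : A) : V :=
  \sum_k g k *~ coord a 0 k.

(** [twist t a] is (-1)^(t|a|) a for homogeneous a. *)
Definition twist (t : bool) (a : A) : A :=
  linext (fun k => (-1) ^+ (t && par k) * bas k) a.

(** The tensor square of A: the matrix T stands for the sum of the
    T i j (bas i (x) bas j). *)
Local Notation AA := 'M[int]_(rk A).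

Definition tens (a b : A) : AA := \matrix_(i, j) (coord a 0 i * coord b 0 j).

(** The linear map al (x) be. *)
Definition tmap (al be : A -> A) (T : AA) : AA :=
  \sum_i \sum_j T i j *: tens (al (bas i)) (be (bas j)).

(** a (x) b |-> (-1)^(|a||b|) b (x) a. *)
Definition tswap (T : AA) : AA :=
  \matrix_(i, j) ((-1) ^+ (par i && par j) * T j i).

(** <a (x) b, c (x) d> = (-1)^(|b||c|) <a, c> <b, d>. *)
Definition tpairing (T T' : AA) : int :=
  \sum_i \sum_j \sum_k \sum_l
    (-1) ^+ (par j && par k) * T i j * T' k l
      * pairing (bas i) (bas k) * pairing (bas j) (bas l).

Definition gram : AA := \matrix_(i, j) pairing (bas i) (bas j).

(** The coproduct, in closed form; characterized by [comultP] and [comult_uniq]. *)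
Definition comult (a : A) : AA :=
  invmx gram^T
    *m (\matrix_(k, l) ((-1) ^+ (par k && par l) * pairing a (bas k * bas l)))
    *m invmx gram.

Definition casimir : AA := comult 1.

(** Cochains.  A^(x)n is free on the words of length n in the basis, so that an
    element of CH^n(A, A) = Hom(A^(x)n, A) is a function on these words, and a
    function on all words is a family (f_n)_n with f_n in CH^n(A, A).
    Similarly CH^p (x) CH^q = Hom(A^(x)p (x) A^(x)q, A (x) A) is the set of
    functions on pairs of words of lengths p and q, where
    (f (x) g)(u (x) v) = (-1)^(|g||u|) f(u) (x) g(v).
    Koszul signs come separately from the Hochschild degree and from the
    parity of A. *)
Definition word := seq 'I_(rk A).
Definition cochain := word -> A.
Definition bicochain := word -> word -> AA.
Definition operation := cochain -> bicochain.

Definition wpar (w : word) : bool := foldr (fun i b => par i (+) b) false w.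

(** The inner faces: the sum over i of
    (-1)^(i+1) g(w_0, ..., w_i w_(i+1), ..., w_n). *)
Definition inner (V : zmodType) (g : word -> V) (w : word) : V :=
  if w is a :: w' then
    \sum_(i < size w')
      linext (fun k => g (take i w ++ k :: drop i.+2 w))
             (bas (nth a w i) * bas (nth a w i.+1)) *~ (-1) ^+ i.+1
  else 0.

(** The Hochschild differential; a basis element a in front of f(w') has been
    moved past f, whose parity is that of w' plus that of the value f(w'). *)
Definition hdiff (f : cochain) : cochain := fun w =>
  if w is a :: w' then
    (-1) ^+ (par a && wpar w') * (bas a * twist (par a) (f w'))
    + inner f w
    + (-1) ^+ size w * (f (belast a w') * bas (last a w'))
  else 0.

(** hdiff (x) id *)
Definition hdiff1 (F : bicochain) : bicochain := fun u v =>
  if u is a :: u' then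
    (-1) ^+ (par a && (wpar u' (+) wpar v))
      *: tmap (fun x => bas a * twist (par a) x) (twist (par a)) (F u' v)
    + inner (F ^~ v) u
    + (let z := last a u' in
       (-1) ^+ (size u + (par z && wpar v))
         *: tmap (fun x => x * bas z) (twist (par z)) (F (belast a u') v))
  else 0.

(** id (x) hdiff, without the sign from the Hochschild degree of the first
    factor, which is added in [hdiff_tot] *)
Definition hdiff2 (F : bicochain) : bicochain := fun u v =>
  if v is b :: v' then
    (-1) ^+ (par b && wpar v')
      *: tmap id (fun y => bas b * twist (par b) y) (F u v')
    + inner (F u) v
    + (-1) ^+ size v *: tmap id (fun y => y * bas (last b v')) (F u (belast b v'))
  else 0.

Definition hdiff_tot (F : bicochain) : bicochain := fun u v =>
  hdiff1 F u v + (-1) ^+ size u *: hdiff2 F u v.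

(** The coproduct
      (-1)^p sum f(u (x) C_1^(2) C_2^(1) (x) v) C_1^(1) (x) C_2^(2),  p = |u|,
    the last sign below being the Koszul sign of the permutation
      f u C_1^(1) C_1^(2) C_2^(1) C_2^(2) v -> f u C_1^(2) C_2^(1) v C_1^(1) C_2^(2).
    For (graded) commutative A this is
      (-1)^p sum C_1^(1) f(u (x) C_2^(1) C_1^(2) (x) v) (x) C_2^(2),
    see [DeltaCH_supercommutative].  For noncommutative A the two products in
    the latter have to be read in the opposite order, as here, in order to be
    compatible with [hdiff]. *)
Definition DeltaCH : operation := fun f u v =>
  (-1) ^+ size u *:
    \sum_i \sum_j \sum_k \sum_l
      (casimir i j * casimir k l
         * (-1) ^+ ((par i && (par j (+) par k (+) wpar v))
                    (+) (par l && wpar v)))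
      *: tens (linext (fun m => f (u ++ m :: v)) (bas j * bas k) * bas i) (bas l).

(** The signed interchange f (x) g |-> (-1)^(pq + |f||g|) g (x) f. *)
Definition flip (F : bicochain) : bicochain := fun u v =>
  (-1) ^+ (size u * size v + (wpar u && wpar v))%N *: tswap (F v u).

Definition DeltaCH_op : operation := fun f => flip (DeltaCH f).

Definition Delta_sym : operation := fun f u v =>
  DeltaCH f u v + DeltaCH_op f u v.

(** Graded commutators with the differentials of an operation that lowers the
    Hochschild degree by 1, resp. 2. *)
Definition comm1 (O : operation) : operation := fun f u v =>
  hdiff_tot (O f) u v + O (hdiff f) u v.

Definition comm2 (H : operation) : operation := fun f u v =>
  hdiff_tot (H f) u v - H (hdiff f) u v.

Definition well_defined (O : operation) : Prop :=
  forall f u v, comm1 O f u v = 0.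

(** H is given by linear maps CH^(n+d) -> (CH (x) CH)^n. *)
Definition linear_of_degree (d : nat) (H : operation) : Prop :=
  (forall f g u v, H (f \+ g) u v = H f u v + H g u v) /\
  (forall n (f g : cochain),
     (forall w, size w = (n + d)%N -> f w = g w) ->
     forall u v, (size u + size v = n)%N -> H f u v = H g u v).

(** For a submodule K of A = CH^0(A, A): the kernel
    K (x) CH + CH (x) K of CH (x) CH -> (CH / K) (x) (CH / K). *)
Definition tens_span (K L : A -> Prop) (T : AA) : Prop :=
  exists s : seq (A * A),
    (forall x, x \in s -> K x.1 /\ L x.2) /\ T = \sum_(x <- s) tens x.1 x.2.

Definition zero_mod (K : A -> Prop) (F : bicochain) : Prop :=
  exists F1 F2 : bicochain,
    [/\ forall u v, F u v = F1 u v + F2 u v,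
        forall u v, u != [::] -> F1 u v = 0,
        forall v, tens_span K (fun=> True) (F1 [::] v),
        forall u v, v != [::] -> F2 u v = 0
      & forall u, tens_span (fun=> True) K (F2 u [::])].

Definition well_defined_mod (K : A -> Prop) (O : operation) : Prop :=
  forall f, zero_mod K (comm1 O f).

Definition null_homotopic_mod (K : A -> Prop) (O : operation) : Prop :=
  exists H : operation,
    linear_of_degree 2 H /\
    forall f, zero_mod K (fun u v => O f u v - comm2 H f u v).

Definition cocommutative_mod (K : A -> Prop) : Prop :=
  well_defined_mod K DeltaCH /\ null_homotopic_mod K Delta_sym.

Definition CH0 : A -> Prop := fun=> True.

(** Normalized cochains: those vanishing whenever an argument is 1. *)
Definition normalized (f : cochain) : Prop :=
  forall u v, linext (fun k => f (u ++ k :: v)) 1 = 0.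

Definition binormalized (F : bicochain) : Prop :=
  (forall u u' v, linext (fun k => F (u ++ k :: u') v) 1 = 0) /\
  (forall u v v', linext (fun k => F u (v ++ k :: v')) 1 = 0).

Definition cochain_in (K : A -> Prop) (f : cochain) : Prop :=
  K (f [::]) /\ forall w, w != [::] -> f w = 0.

(** O induces an operation on the normalized cochains modulo K. *)
Definition descends (K : A -> Prop) (O : operation) : Prop :=
  (forall f, normalized f -> binormalized (O f)) /\
  (forall f, cochain_in K f -> zero_mod K (O f)).

(** Cocommutativity up to homotopy in the normalized complex modulo K. *)
Definition cocommutative_normalized_mod (K : A -> Prop) : Prop :=
  [/\ descends K DeltaCH,
      forall f, normalized f -> zero_mod K (comm1 DeltaCH f)
    & exists H : operation,
        [/\ linear_of_degree 2 H,
            descends K H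
          & forall f, normalized f ->
              zero_mod K (fun u v => Delta_sym f u v - comm2 H f u v)]].

(** Graded Gorenstein structures; [gr i] is the projection of A onto A_i.  The
    grading refines the Z/2-graded module structure, but the parity need not be
    the degree modulo 2. *)
Record gorenstein := Gorenstein {
  socle : nat;
  gr : nat -> {additive A -> A};
  e_top : A;
  gr_gr : forall i j a, gr i (gr j a) = if i == j then gr i a else 0;
  gr_sum : forall a, \sum_(i < socle.+1) gr i a = a;
  gr_twist : forall i a, gr i (twist true a) = twist true (gr i a);
  gr_mul : forall i j a b, gr (i + j)%N (gr i a * gr j b) = gr i a * gr j b;
  gr_0 : forall a, gr 0%N a = a <-> exists z : int, a = z%:~R;
  e_top_gr : gr socle e_top = e_top;
  e_top_counit : counit e_top = 1;
  e_top_span : forall a, gr socle a = a -> exists z : int, a = e_top *~ z;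
  gr_pairing : forall i j a b,
    (i + j)%N != socle -> pairing (gr i a) (gr j b) = 0
}.

(** The constants of CH^0(A): the functionals <a, -> that vanish on the part
    of A of positive degree. *)
Definition constants (G : gorenstein) : A -> Prop := fun a =>
  forall b, gr G 0%N b = 0 -> pairing a b = 0.

(** The reduced complex is the normalized complex modulo constants. *)
Definition cocommutative_reduced (G : gorenstein) : Prop :=
  cocommutative_normalized_mod (constants G).

Lemma pairing_addl (b : A) :
  exists L : {additive A -> int}, forall a, L a = pairing a b.
Proof.
have B : zmod_morphism (fun a : A => pairing a b).
  by move=> x y; apply: (addIr (pairing y b)); rewrite -pairingDl !subrK.
pose L : {additive A -> int} :=
  HB.pack (fun a : A => pairing a b) (GRing.isZmodMorphism.Build _ _ _ B).
by exists L.
Qed.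

Lemma pairing_addr (a : A) :
  exists L : {additive A -> int}, forall b, L b = pairing a b.
Proof.
have B : zmod_morphism (fun b : A => pairing a b).
  by move=> x y; apply: (addIr (pairing a y)); rewrite -pairingDr !subrK.
pose L : {additive A -> int} :=
  HB.pack (fun b : A => pairing a b) (GRing.isZmodMorphism.Build _ _ _ B).
by exists L.
Qed.

Lemma pairing_linl (I : finType) (g : I -> A) (z : I -> int) b :
  pairing (\sum_i g i *~ z i) b = \sum_i z i * pairing (g i) b.
Proof.
have [L HL] := pairing_addl b; rewrite -HL raddf_sum; apply: eq_bigr => i _.
by rewrite raddfMz HL -mulrzr mulrC intz.
Qed.

Lemma pairing_linr (I : finType) (g : I -> A) (z : I -> int) a :
  pairing a (\sum_i g i *~ z i) = \sum_i z i * pairing a (g i).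
Proof.
have [L HL] := pairing_addr a; rewrite -HL raddf_sum; apply: eq_bigr => i _.
by rewrite raddfMz HL -mulrzr mulrC intz.
Qed.

Lemma coordD (a b : A) : coord (a + b) = coord a + coord b.
Proof.
rewrite -{1}[a]coordK -{1}[b]coordK -big_split /= -[RHS]basK.
by congr coord; apply: eq_bigr => i _; rewrite mxE mulrzDr.
Qed.

Lemma coordB (a b : A) : coord (a - b) = coord a - coord b.
Proof. by apply: (addIr (coord b)); rewrite -coordD !subrK. Qed.

Lemma coordN (a : A) : coord (- a) = - coord a.
Proof.
by apply: (addrI (coord a)); rewrite -coordD !subrr -(subrr a) coordB subrr.
Qed.

Lemma coord_bas j i : coord (bas j : A) 0 i = (j == i)%:R.
Proof.
have -> : bas j = \sum_k bas k *~ (delta_mx 0 j : 'rV[int]_(rk A)) 0 k :> A.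
  rewrite (bigD1 j) //= mxE !eqxx mulr1z big1 ?addr0 // => k kj.
  by rewrite mxE (negbTE kj) andbF mulr0z.
by rewrite basK mxE eqxx eq_sym.
Qed.

Lemma gram_unit : gram \in unitmx.
Proof.
have ex i : exists a : A, forall b, pairing a b = coord b 0 i.
  pose l (b : A) := coord b 0 i.
  have lB : zmod_morphism l by move=> x y; rewrite /l coordB !mxE.
  pose L : {additive A -> int} := HB.pack l (GRing.isZmodMorphism.Build _ _ l lB).
  by have [a [Ha _]] := frob_perfect L; exists a => b; rewrite Ha.
have [M HM] : exists M : AA, M *m gram = 1%:M.
  have /fin_all_exists [a Ha] := ex.
  exists (\matrix_(i, j) coord (a i) 0 j); apply/matrixP => i j.
  rewrite [RHS]mxE eq_sym -coord_bas -Ha -{1}[a i]coordK pairing_linl mxE.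
  by apply: eq_bigr => k _; rewrite !mxE.
by have [] := mulmx1_unit HM.
Qed.

Lemma tpairing_tens T (b c : A) :
  tpairing T (tens b c) =
  \sum_k \sum_l coord b 0 k * (coord c 0 l *
     ((-1) ^+ (par k && par l) * (gram^T *m T *m gram) k l)).
Proof.
rewrite /tpairing (eq_bigr (fun i => \sum_k \sum_j \sum_l
  (-1) ^+ (par j && par k) * T i j * tens b c k l
    * pairing (bas i) (bas k) * pairing (bas j) (bas l))); last first.
  by move=> i _; rewrite exchange_big.
rewrite exchange_big; apply: eq_bigr => k _.
rewrite (eq_bigr (fun i => \sum_l \sum_j
  (-1) ^+ (par j && par k) * T i j * tens b c k l
    * pairing (bas i) (bas k) * pairing (bas j) (bas l))); last first.
  by move=> i _; rewrite exchange_big.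
rewrite exchange_big; apply: eq_bigr => l _.
rewrite !mxE !mulr_sumr exchange_big; apply: eq_bigr => j _.
rewrite mxE mulr_suml !mulr_sumr; apply: eq_bigr => i _; rewrite !mxE.
have [->|/pairing_even ->] := eqVneq (pairing (bas j : A) (bas l)) 0.
  by rewrite !mulr0.
rewrite [par l && _]andbC; set s := (-1) ^+ _.
ring.
Qed.

Lemma tpairing_bas T k l :
  tpairing T (tens (bas k) (bas l : A)) =
  (-1) ^+ (par k && par l) * (gram^T *m T *m gram) k l.
Proof.
rewrite tpairing_tens (bigD1 k) //= [X in _ + X]big1 ?addr0; last first.
  by move=> i /negbTE ik; apply: big1 => j _; rewrite coord_bas eq_sym ik mul0r.
rewrite (bigD1 l) //= [X in _ + X]big1 ?addr0; last first.
  by move=> j /negbTE jl; rewrite [coord _ 0 j]coord_bas eq_sym jl mul0r mulr0.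
by rewrite !coord_bas !eqxx !mul1r.
Qed.

Lemma comult_gram (a : A) : gram^T *m comult a *m gram =
  \matrix_(k, l) ((-1) ^+ (par k && par l) * pairing a (bas k * bas l)).
Proof.
have U : gram^T \in unitmx by rewrite unitmx_tr gram_unit.
by rewrite /comult !mulmxA mulmxV // mul1mx mulmxKV // gram_unit.
Qed.

(** The defining property <comult a, b (x) c> = <a, bc> of the coproduct. *)
Lemma comultP (a b c : A) : tpairing (comult a) (tens b c) = pairing a (b * c).
Proof.
rewrite tpairing_tens comult_gram -{2}[b]coordK mulr_suml.
under [in RHS]eq_bigr => k _ do rewrite mulrzAl.
rewrite pairing_linr; apply: eq_bigr => k _.
rewrite -{2}[c]coordK mulr_sumr.
under [in RHS]eq_bigr => l _ do rewrite mulrzAr.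
rewrite pairing_linr mulr_sumr; apply: eq_bigr => l _.
by rewrite mxE signrMK.
Qed.

Lemma comult_uniq (a : A) T :
  (forall b c, tpairing T (tens b c) = pairing a (b * c)) -> T = comult a.
Proof.
move=> HT; have U : gram^T \in unitmx by rewrite unitmx_tr gram_unit.
apply: (can_inj (mulKmx U)); apply: (can_inj (mulmxK gram_unit)).
rewrite comult_gram; apply/matrixP => k l.
by rewrite [RHS]mxE -HT tpairing_bas signrMK.
Qed.

Lemma casimir_even i j : casimir i j != 0 -> par i = par j.
Proof.
pose P : AA := diag_mx (\row_k (-1) ^+ par k).
have PE (M : AA) : (forall k l, M k l != 0 -> par k = par l) <-> P *m M *m P = M.
  have E k l : (P *m M *m P) k l = (-1) ^+ (par k (+) par l) * M k l.
    by rewrite mul_mx_diag mul_diag_mx !mxE signr_addb mulrAC.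
  split=> [H|H k l].
    apply/matrixP => k l; rewrite E; have [->|/H ->] := eqVneq (M k l) 0.
      by rewrite mulr0.
    by rewrite addbb mul1r.
  have := E k l; rewrite H; case: (par k) (par l) => [] [] //= /eqP;
    by rewrite expr1 mulN1r eq_sym Num.Theory.eqNr => ->.
have PP : P *m P = 1%:M.
  apply/matrixP => k l; rewrite mul_diag_mx !mxE.
  by case: eqP => [->|_]; rewrite ?mulr1n ?mulr0n ?mulr0 // -signr_addb addbb.
have PV (M : AA) : M \in unitmx -> P *m M *m P = M ->
    P *m invmx M *m P = invmx M.
  move=> MU PM; apply: (can_inj (mulKmx MU)); rewrite mulmxV //.
  rewrite -{1}PM -!mulmxA [P *m (P *m _)]mulmxA PP mul1mx.
  by rewrite [M *m (invmx M *m _)]mulmxA mulmxV // mul1mx PP.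
have PM3 (M N Q : AA) : P *m M *m P = M -> P *m N *m P = N -> P *m Q *m P = Q ->
    P *m (M *m N *m Q) *m P = M *m N *m Q.
  move=> HM HN HQ; rewrite -{1}HM -{1}HN -{1}HQ -!mulmxA.
  by rewrite PP mulmx1 !(mulmxA P P) PP !mul1mx.
move: i j; apply/PE; apply: PM3.
- apply: PV; first by rewrite unitmx_tr gram_unit.
  by apply/PE => k l; rewrite !mxE => /pairing_even.
- apply/PE => k l; rewrite mxE pairing_assoc mul1r mulf_eq0 negb_or.
  by case/andP=> _ /pairing_even.
- by apply: PV gram_unit _; apply/PE => k l; rewrite !mxE => /pairing_even.
Qed.

Definition supercommutative : Prop :=
  forall i j, bas i * bas j = (-1) ^+ (par i && par j) * (bas j * bas i) :> A.

Lemma mul_bas_twist (z : A) i :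
  supercommutative -> z * bas i = bas i * twist (par i) z.
Proof.
move=> sc; rewrite -{1}[z]coordK mulr_suml mulr_sumr; apply: eq_bigr => k _.
rewrite mulrzAl sc mulrzAr; congr (_ *~ _).
by rewrite andbC mulrA [in RHS]mulrA; congr (_ * _); rewrite commr_sign.
Qed.

(** The last sign is the Koszul sign of
      C_1^(1) C_1^(2) f u C_2^(1) C_2^(2) v -> C_1^(1) f u C_2^(1) C_1^(2) v C_2^(2),
    where the parity of f is read off from its arguments and its value. *)
Lemma DeltaCH_supercommutative (f : cochain) (u v : word) :
  supercommutative ->
  DeltaCH f u v =
  (-1) ^+ size u *:
    \sum_i \sum_j \sum_k \sum_l
      (casimir i j * casimir k l
         * (-1) ^+ ((par j && (par j (+) wpar v)) (+) (par l && wpar v)))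
      *: tens (bas i * twist (par j)
                 (linext (fun m => f (u ++ m :: v)) (bas k * bas j))) (bas l).
Proof.
move=> sc; rewrite /DeltaCH; congr (_ *: _).
apply: eq_bigr => i _; apply: eq_bigr => j _; apply: eq_bigr => k _.
apply: eq_bigr => l _.
have [->|/casimir_even pij] := eqVneq (casimir i j) 0; first by rewrite !mul0r !scale0r.
have linextN (g : 'I_(rk A) -> A) (a : A) : linext g (- a) = - linext g a.
  rewrite /linext -sumrN; apply: eq_bigr => m _.
  by rewrite coordN mxE mulrNz.
have linextZ (g : 'I_(rk A) -> A) (b : bool) (a : A) :
    linext g ((-1) ^+ b * a) = (-1) ^+ b * linext g a.
  by case: b; rewrite ?expr1 ?expr0 ?mul1r // !mulN1r linextN.
have tensN (a b : A) : tens (- a) b = - tens a b.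
  by apply/matrixP => m n; rewrite !mxE coordN mxE mulNr.
have tensZ (b : bool) (x y : A) :
    tens ((-1) ^+ b * x) y = (-1) ^+ b *: tens x y.
  by case: b; rewrite ?expr1 ?expr0 ?mul1r ?scale1r // mulN1r scaleN1r tensN.
rewrite sc linextZ -[X in tens X _]mulrA tensZ scalerA mul_bas_twist // pij -mulrA -signr_addb.
congr ((_ * (-1) ^+ (_ : bool)) *: _).
by case: (par j); case: (par k); case: (wpar v); case: (par l).
Qed.

End Frobenius.

(* Main.v *)
(** A bicochain is read as a functional on pairs of cyclic words ua, vb, the last
    letters being the coefficients against which the two values are paired. The
    coproduct of phi becomes the sum of phi over the words u (a C' b) v, C'', where
    C' (x) C'' is the Casimir element, and its opposite the one over v (b C' a) u, C''.
    Up to the position of the last letter these are the same cyclic word, and the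
    homotopy is the sum of phi(w, 1) over the linear words w obtained from
    u (a C' b) v C'' by moving the letters of u, one by one, to the end. In its
    boundary the letter 1 absorbs either neighbour; these terms cancel between
    consecutive rotations, and the two that remain are the coproduct and its
    opposite. All other terms match the differentials of ua and vb, except that
    for empty v the letters a C' b and C'' are neighbours and produce the handle
    element C' b C''. In the graded Gorenstein case C' b C'' vanishes for b of positive
    degree, since its degree exceeds the socle. *)
From mathcomp Require Import all_boot all_order all_algebra.
From mathcomp Require Import ring.
Require Import Defs.

Set Implicit Arguments.
Unset Strict Implicit.
Unset Printing Implicit Defensive.

Import GRing.Theory.
Local Open Scope ring_scope.

(** Pairing the values away turns each operation into an integer functional on words; the Hochschild
    differential becomes a signed sum over products of neighbours in a cyclic word. The Frobenius
    property enters as invariance of the Casimir element: a factor to the left of [C'] may be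
    carried to the right of [C''], and one to the right of [C'] to the left of [C'']. Thus a product
    of a Casimir leg with a letter becomes a product of neighbours in [ua] or [vb], and only a
    product of the two legs with each other resists. The handle element that then arises is graded
    central. Hence the two failures of the coproduct to commute with the differentials, one for each
    output factor, cancel in the symmetrization, which is well defined without any quotient. Each
    failure sits in an output factor without arguments and lies in the annihilator of every
    twist-stable [N] on which the handle operator vanishes. Taking [N] to be zero gives [CH0],
    taking the elements without degree 0 part gives the constants, so one argument serves both
    quotients. *)

Section Additive.
Variables U V : zmodType.

(** Additivity stays an unbundled predicate, since it is needed for functions assembled on the spot
    from words, products and Casimir sums. *)
Definition addf (f : U -> V) := forall x y, f (x + y) = f x + f y.

Variable f : U -> V.
Hypothesis fD : addf f.

Lemma addf0 : f 0 = 0.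
Proof. by apply: (addrI (f 0)); rewrite -fD !addr0. Qed.

Lemma addfN x : f (- x) = - f x.
Proof. by apply: (addrI (f x)); rewrite -fD !subrr addf0. Qed.

Lemma addf_sum (I : Type) (r : seq I) (P : pred I) (F : I -> U) :
  f (\sum_(i <- r | P i) F i) = \sum_(i <- r | P i) f (F i).
Proof. exact: (big_morph f fD addf0). Qed.

Lemma addfMz x z : f (x *~ z) = f x *~ z.
Proof.
have natM (n : nat) : f (x *+ n) = f x *+ n.
  by elim: n => [|n IH]; rewrite ?mulr0n ?addf0 // !mulrS fD IH.
by case: z => n; rewrite ?NegzE ?mulrNz -!pmulrn ?addfN natM.
Qed.

Lemma addf_sign x (b : nat) : f (x *~ (-1) ^+ b) = f x *~ (-1) ^+ b.
Proof. exact: addfMz. Qed.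

End Additive.

Notation sg b := ((-1) ^+ (b : bool) : int).

Lemma sgM (a b : bool) : sg a * sg b = sg (a (+) b).
Proof. by rewrite signr_addb. Qed.

Lemma sgN (b : bool) : sg (~~ b) = - sg b.
Proof. by case: b. Qed.

Lemma sg_size (T : Type) (s : seq T) : (-1) ^+ size s = sg (odd (size s)).
Proof. by rewrite signr_odd. Qed.

Arguments inner : simpl never.

(** Verifies an identity between polynomials in signs by running through all
    values of the booleans occurring in the exponents. *)
Ltac sg_case :=
  match goal with
  | |- context [nat_of_bool ?b] => sg_atom b
  end
with sg_atom b :=
  lazymatch b with
  | ?c (+) ?d => sg_atom2 c d
  | ?c && ?d => sg_atom2 c d
  | ~~ ?c => sg_atom c
  | true => fail
  | false => fail
  | _ => let p := fresh in generalize b => p; case: p => /=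
  end
with sg_atom2 c d := first [sg_atom c | sg_atom d].
Ltac sg_ring := repeat sg_case; rewrite ?(addbF, addbT, negbK, expr0, expr1); ring.

(** * Linear extension from basis letters, parities of words *)

Section Words.
Variable A : frobeniusAlgebra.
Local Notation I := 'I_(rk A).
Local Notation word := (word A).
Local Notation par := (@par A).
Local Notation bas := (@bas A).
Implicit Types (x y z : A) (u v w r : word) (i j k l : I).

Lemma linextD (V : zmodType) (g : I -> V) : addf (linext g).
Proof.
move=> x y; rewrite /linext -big_split; apply: eq_bigr => k _ /=.
by rewrite coordD mxE mulrzDr.
Qed.

Lemma linext_bas (V : zmodType) (g : I -> V) k : linext g (bas k) = g k.
Proof.
rewrite /linext (bigD1 k) //= big1 => [|i ik].
  by rewrite coord_bas eqxx addr0.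
by rewrite coord_bas eq_sym (negbTE ik).
Qed.

Lemma eq_linext (V : zmodType) (g h : I -> V) x :
  (forall k, coord x 0 k != 0 -> g k = h k) -> linext g x = linext h x.
Proof.
move=> gh; apply: eq_bigr => k _; have [->|/gh ->//] := eqVneq (coord x 0 k) 0.
by rewrite !mulr0z.
Qed.

Lemma linext_addf (V : zmodType) (f : A -> V) x :
  addf f -> linext (fun k => f (bas k)) x = f x.
Proof.
move=> fD; rewrite -{2}[x]coordK (addf_sum fD).
by apply: eq_bigr => k _; rewrite (addfMz fD).
Qed.

Lemma addf_linext (V W : zmodType) (f : V -> W) (g : I -> V) x :
  addf f -> f (linext g x) = linext (fun k => f (g k)) x.
Proof.
move=> fD; rewrite /linext (addf_sum fD).
by apply: eq_bigr => k _; rewrite (addfMz fD).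
Qed.

Lemma linext_fD (V : zmodType) (g h : I -> V) x :
  linext (fun k => g k + h k) x = linext g x + linext h x.
Proof.
by rewrite /linext -big_split; apply: eq_bigr => k _; rewrite mulrzDl.
Qed.

Lemma linext_f0 (V : zmodType) x : linext (fun _ => 0 : V) x = 0.
Proof. by rewrite /linext big1 // => k _; rewrite mul0rz. Qed.

Lemma linext_fZ (g : I -> int) (c : int) x :
  linext (fun k => c * g k) x = c * linext g x.
Proof. by symmetry; apply: (addf_linext (f := *%R c)) => y z; rewrite mulrDr. Qed.

Lemma linext_fsum (V : zmodType) (J : Type) (s : seq J) (P : pred J)
    (g : J -> I -> V) x :
  linext (fun k => \sum_(j <- s | P j) g j k) x =
  \sum_(j <- s | P j) linext (g j) x.
Proof.
rewrite /linext exchange_big /=; apply: eq_bigr => k _.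
by rewrite (addf_sum (f := fun y : V => y *~ _)) // => y z; rewrite mulrzDl.
Qed.

Lemma linext_comp (V : zmodType) (f : A -> A) (g : I -> V) x :
  addf f -> linext (fun k => linext g (f (bas k))) x = linext g (f x).
Proof.
move=> fD; rewrite (linext_addf (f := fun y => linext g (f y))) // => y z.
by rewrite fD linextD.
Qed.

Lemma addf_mull x : addf (fun y : A => x * y).
Proof. by move=> y z; rewrite mulrDr. Qed.

Lemma addf_mulr x : addf (fun y : A => y * x).
Proof. by move=> y z; rewrite mulrDl. Qed.

(** A sign depending on the parity of a product is determined by the factors. *)
Lemma linext_par (V : zmodType) (g : bool -> I -> V) i j :
  linext (fun k => g (par k) k) (bas i * bas j) =
  linext (g (par i (+) par j)) (bas i * bas j).
Proof. by apply: eq_linext => k /par_mul ->. Qed.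

Lemma linext_par1 (V : zmodType) (g : bool -> I -> V) :
  linext (fun k => g (par k) k) 1 = linext (g false) 1.
Proof. by apply: eq_linext => k /par_one ->. Qed.

Lemma wpar_cat u v : wpar (u ++ v) = wpar u (+) wpar v.
Proof. by elim: u => //= i u ->; rewrite addbA. Qed.

Lemma wpar_rcons u i : wpar (rcons u i) = wpar u (+) par i.
Proof. by rewrite -cats1 wpar_cat /= addbF. Qed.

(** Words are taken apart from the right because the last letter is the coefficient; a word without
    coefficient gets the value 0. *)
Definition onlast (V : zmodType) (g : word -> I -> V) (w : word) : V :=
  if w is i :: w' then g (belast i w') (last i w') else 0.

Lemma onlast_rcons (V : zmodType) (g : word -> I -> V) w i :
  onlast g (rcons w i) = g w i.
Proof. by case: w => [|j w] //=; rewrite /onlast /= belast_rcons last_rcons. Qed.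

Lemma inner_nil (V : zmodType) (g : word -> V) : inner g [::] = 0.
Proof. by []. Qed.

Lemma inner1 (V : zmodType) (g : word -> V) i : inner g [:: i] = 0.
Proof. by rewrite /inner big_ord0. Qed.

Lemma inner_cons2 (V : zmodType) (g : word -> V) i j w :
  inner g [:: i, j & w] =
  - linext (fun k => g (k :: w)) (bas i * bas j)
  - inner (fun w => g (i :: w)) (j :: w).
Proof.
rewrite /inner big_ord_recl /= drop0; congr (_ + _).
rewrite -sumrN; apply: eq_bigr => m _ /=.
rewrite [in RHS](set_nth_default i) ?ltnS 1?ltnW // [in RHS](set_nth_default i j) //.
by rewrite exprS mulN1r mulrNz.
Qed.

End Words.

Arguments onlast : simpl never.

(** * Inner faces and the cyclic face *)

Section Inner.
Variable A : frobeniusAlgebra.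
Local Notation I := 'I_(rk A).
Local Notation word := (word A).
Local Notation par := (@par A).
Local Notation bas := (@bas A).
Implicit Types (x y z : A) (u v w r : word) (i j k l : I).

(** A face shortens the word by one letter and keeps its parity. Signs depending on size or parity
    can therefore be pulled out of [inner]. *)
Lemma eq_inner (V : zmodType) (g h : word -> V) w0 :
  (forall w, size w = (size w0).-1 -> wpar w = wpar w0 -> g w = h w) ->
  inner g w0 = inner h w0.
Proof.
elim: w0 g h => [|i [|j w] IH] g h gh //; first by rewrite !inner1.
rewrite !inner_cons2; congr (- _ - _).
  apply: eq_linext => k /par_mul pk; apply: gh => //=.
  by rewrite pk addbA.
by apply: IH => w' sw pw; apply: gh => /=; rewrite ?sw ?pw.
Qed.

Lemma addf_inner (V W : zmodType) (f : V -> W) (g : word -> V) w :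
  addf f -> f (inner g w) = inner (fun w => f (g w)) w.
Proof.
move=> fD; elim: w g => [|i [|j w] IH] g; first exact: addf0 fD.
  by rewrite !inner1 (addf0 fD).
by rewrite !inner_cons2 fD !(addfN fD) (addf_linext _ _ fD) IH.
Qed.

Lemma innerD (V : zmodType) (g h : word -> V) w :
  inner (fun w => g w + h w) w = inner g w + inner h w.
Proof.
elim: w g h => [|i [|j w] IH] g h; first by rewrite addr0.
  by rewrite !inner1 addr0.
by rewrite !inner_cons2 IH linext_fD !opprD addrACA.
Qed.

Lemma inner0 (V : zmodType) w : inner (fun _ => 0 : V) w = 0.
Proof. by apply: (addrI (inner (fun _ => 0) w)); rewrite -innerD !addr0. Qed.

Lemma innerZ (g : word -> int) (c : int) w :
  inner (fun w => c * g w) w = c * inner g w.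
Proof. by symmetry; apply: (addf_inner (f := *%R c)) => x y; rewrite mulrDr. Qed.

Lemma inner_sum (V : zmodType) (J : Type) (s : seq J) (g : J -> word -> V) w :
  inner (fun w => \sum_(j <- s) g j w) w = \sum_(j <- s) inner (g j) w.
Proof.
elim: s => [|j s IH].
  rewrite big_nil -[RHS](inner0 V w).
  by apply: eq_inner => ? _ _; rewrite big_nil.
by rewrite big_cons -IH -innerD; apply: eq_inner => ? _ _; rewrite big_cons.
Qed.

(** The face across the cut between the two words. *)
Definition junc (g : word -> int) (w1 w2 : word) : int :=
  onlast (fun w i => if w2 is j :: w'
    then linext (fun k => g (w ++ k :: w')) (bas i * bas j) else 0) w1.

Lemma inner_cat (g : word -> int) w1 w2 :
  inner g (w1 ++ w2) = inner (fun w => g (w ++ w2)) w1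
    + (-1) ^+ size w1 * (junc g w1 w2 + inner (fun w => g (w1 ++ w)) w2).
Proof.
elim: w1 g => [|i [|j w] IH] g /=.
- by rewrite add0r mul1r /junc /= !add0r.
- rewrite inner1 add0r expr1 mulN1r /junc /=.
  case: w2 {IH} => [|j w]; first by rewrite inner1 addr0 oppr0.
  by rewrite inner_cons2 opprD.
- rewrite inner_cons2 -cat_cons IH inner_cons2.
  rewrite -!addrA; congr (_ + _); rewrite opprD; congr (_ + _).
  by rewrite [in RHS]exprS mulN1r mulNr.
Qed.

Definition addlast (g : word -> int) (w : word) (j : I) : int :=
  onlast (fun w i => linext (fun k => g (rcons w k)) (bas i * bas j)) w.

Lemma inner_cons (g : word -> int) i w :
  inner g (i :: w) =
  - (if w is j :: w' then linext (fun k => g (k :: w')) (bas i * bas j) else 0)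
  - inner (fun w => g (i :: w)) w.
Proof.
by case: w => [|j w]; rewrite ?inner_cons2 // inner1 inner_nil subr0 oppr0.
Qed.

Lemma inner_rcons (g : word -> int) w i :
  inner g (rcons w i) = inner (fun w => g (rcons w i)) w
    + (-1) ^+ size w * addlast g w i.
Proof.
rewrite -cats1 inner_cat inner1 addr0; congr (_ + _ * _).
  by apply: eq_inner => w' _ _; rewrite cats1.
rewrite /junc /addlast; case: w => //= j w.
by apply: eq_linext => k _; rewrite cats1.
Qed.

Lemma addlast_nil g j : addlast g [::] j = 0.
Proof. by []. Qed.

Lemma addlast_rcons g w i j :
  addlast g (rcons w i) j = linext (fun k => g (rcons w k)) (bas i * bas j).
Proof. by rewrite /addlast onlast_rcons. Qed.

Lemma addlast_cons g i w j :
  addlast g (i :: w) j =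
  linext (fun k => g (rcons (belast i w) k)) (bas (last i w) * bas j).
Proof. by rewrite [i :: w]lastI addlast_rcons. Qed.

Lemma eq_addlast (g h : word -> int) w0 j :
  (forall w, size w = size w0 -> wpar w = wpar w0 (+) par j -> g w = h w) ->
  addlast g w0 j = addlast h w0 j.
Proof.
case/lastP: w0 => [//|w i] gh; rewrite !addlast_rcons.
apply: eq_linext => k /par_mul pk; apply: gh; rewrite ?size_rcons //.
by rewrite !wpar_rcons pk addbA.
Qed.

Lemma addlastD (g h : word -> int) w j :
  addlast (fun w => g w + h w) w j = addlast g w j + addlast h w j.
Proof.
by case/lastP: w => [|w i]; rewrite ?addr0 // !addlast_rcons linext_fD.
Qed.

Lemma addlastZ (g : word -> int) (c : int) w j :
  addlast (fun w => c * g w) w j = c * addlast g w j.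
Proof.
by case/lastP: w => [|w i]; rewrite ?mulr0 // !addlast_rcons linext_fZ.
Qed.

(** The remaining face of the cyclic bar complex: the first letter is carried past the others and
    multiplies the last one from the right. As [inner] starts with the sign -1, this face has the
    sign +1 up to Koszul signs. *)
Definition wrap (g : word -> int) (w : word) : int :=
  if w is i :: w' then sg (par i && wpar w') * addlast g w' i else 0.

Lemma wrap_rcons g i w k : wrap g (i :: rcons w k) =
  sg (par i && (wpar w (+) par k)) *
  linext (fun l => g (rcons w l)) (bas k * bas i).
Proof. by rewrite /= addlast_rcons wpar_rcons. Qed.

(** The Hochschild differential of a cochain of the form f(w) a, read as a
    functional on the words wa of positive length. *)
Definition dcyc (g : word -> int) (w : word) : int := inner g w + wrap g w.

Lemma eq_wrap (g h : word -> int) w0 :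
  (forall w, size w = (size w0).-1 -> wpar w = wpar w0 -> g w = h w) ->
  wrap g w0 = wrap h w0.
Proof.
case: w0 => //= i w0 gh; congr (_ * _); apply: eq_addlast => w sw pw.
by apply: gh => //; rewrite pw addbC.
Qed.

Lemma wrapD (g h : word -> int) w :
  wrap (fun w => g w + h w) w = wrap g w + wrap h w.
Proof. by case: w => [|i w] //=; rewrite addlastD mulrDr. Qed.

Lemma wrapZ (g : word -> int) (c : int) w :
  wrap (fun w => c * g w) w = c * wrap g w.
Proof. by case: w => [|i w] /=; rewrite ?mulr0 // addlastZ mulrCA. Qed.

Lemma eq_dcyc (g h : word -> int) w0 :
  (forall w, size w = (size w0).-1 -> wpar w = wpar w0 -> g w = h w) ->
  dcyc g w0 = dcyc h w0.
Proof. by move=> gh; congr (_ + _); [apply: eq_inner | apply: eq_wrap]. Qed.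

Lemma dcycD (g h : word -> int) w :
  dcyc (fun w => g w + h w) w = dcyc g w + dcyc h w.
Proof. by rewrite /dcyc innerD wrapD addrACA. Qed.

Lemma dcycZ (g : word -> int) (c : int) w :
  dcyc (fun w => c * g w) w = c * dcyc g w.
Proof. by rewrite /dcyc innerZ wrapZ mulrDr. Qed.

Lemma dcyc1 (g : word -> int) i : dcyc g [:: i] = 0.
Proof. by rewrite /dcyc inner1 /= addlast_nil mulr0 addr0. Qed.

Lemma dcyc_size (g : word -> int) w : (0 < size w)%N ->
  dcyc (fun w => (-1) ^+ size w * g w) w = - (-1) ^+ size w * dcyc g w.
Proof.
move=> w0; rewrite -dcycZ; apply: eq_dcyc => w' -> _.
by rewrite -[in RHS](prednK w0) exprS mulN1r opprK.
Qed.

End Inner.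

Arguments addlast : simpl never.

(** * Boundary of a sum of rotations *)

Section Rotations.
Variable A : frobeniusAlgebra.
Local Notation I := 'I_(rk A).
Local Notation word := (word A).
Local Notation par := (@par A).
Local Notation bas := (@bas A).
Implicit Types (x z : A) (u v w r y : word) (i j k l : I).
Implicit Types (g h : word -> word -> int) (e t : bool).

(** The signed sum of g (r ++ y') y'' over the factorizations y = y' ++ y'' with
    y'' nonempty; t is the parity of the letters that the ones in y' have to be
    moved past in addition to those of y'' and r. *)
Fixpoint rotsum e t g r y : int :=
  if y is i :: y' then
    g r y + sg (e (+) (par i && (t (+) wpar r (+) wpar y')))
            * rotsum e t g (rcons r i) y'
  else 0.

Lemma eq_rotsum e t g h r0 y0 :
  (forall r y, (size r + size y = size r0 + size y0)%N ->
     wpar r (+) wpar y = wpar r0 (+) wpar y0 -> y != [::] -> g r y = h r y) ->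
  rotsum e t g r0 y0 = rotsum e t h r0 y0.
Proof.
elim: y0 r0 => [//|i y IH] r gh /=; rewrite gh //; congr (_ + _ * _).
apply: IH => r' y' s p; apply: gh; first by rewrite s size_rcons addSnnS.
by rewrite p wpar_rcons /= addbA.
Qed.

Lemma rotsumD e t g h r y :
  rotsum e t (fun r y => g r y + h r y) r y = rotsum e t g r y + rotsum e t h r y.
Proof. by elim: y r => [|i y IH] r /=; rewrite ?addr0 // IH mulrDr addrACA. Qed.

Lemma rotsum_size e t g r y :
  rotsum e t (fun r y => (-1) ^+ size y * g r y) r y =
  (-1) ^+ size y * rotsum (~~ e) t g r y.
Proof.
elim: y r => [|i y IH] r /=; first by rewrite mulr0.
rewrite IH exprS mulrDr; congr (_ + _); rewrite addNb sgN; ring.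
Qed.

Lemma rotsum_dcyc e t (g : word -> word -> word -> int) r y v :
  rotsum e t (fun r y => dcyc (fun v => g v r y) v) r y =
  dcyc (fun v => rotsum e t (g v) r y) v.
Proof.
elim: y r => [|i y IH] r /=; last by rewrite IH -dcycZ -dcycD.
by rewrite [RHS](_ : _ = dcyc (fun w => 0 * 0) v) ?dcycZ ?mul0r.
Qed.

Definition jump t g r y : int :=
  if r is i :: r' then sg (par i && t) * addlast (g r') y i else 0.

(** The part of the boundary that a rotated word contributes to a sum of
    rotations; [jump] is the product of the first rotated letter with the
    letter on the other side of the Casimir element. *)
Definition rot_bdry e t g r y : int :=
  inner (g r) y - sg (e (+) odd (size r)) * (jump t g r y + inner (g^~ y) r).

Lemma addlast_rotsum e t g r i y j :
  addlast (rotsum e t g r) (i :: y) j =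
  addlast (g r) (i :: y) j
  + sg (e (+) (par i && (t (+) wpar r (+) wpar y (+) par j)))
    * addlast (rotsum e t g (rcons r i)) y j.
Proof.
case/lastP: y => [|y k].
  rewrite addlast_nil mulr0 addr0.
  by apply: eq_linext => k _ /=; rewrite mulr0 addr0.
rewrite -rcons_cons !addlast_rcons -linext_fZ -linext_fD.
by apply: eq_linext => l /par_mul pl; rewrite /= !wpar_rcons pl !addbA.
Qed.

(** Faces of [y] commute with moving [i], except for the product of [i] with its neighbour: this
    travels as a single letter, and once moved it is the last letter of the rotated part. That is
    the last term. *)
Lemma inner_rotsum e t g r i y :
  inner (rotsum e t g r) (i :: y) = inner (g r) (i :: y)
    - sg (e (+) (par i && (t (+) wpar r (+) wpar y)))
      * inner (rotsum e t g (rcons r i)) y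
    - (if y is j :: y' then
         sg (e (+) ((par i (+) par j) && (t (+) wpar r (+) wpar y')))
         * addlast (fun r => rotsum e t g r y') (rcons r i) j
       else 0).
Proof.
case: y => [|j y]; first by rewrite !inner1 inner_nil mulr0 !subr0.
rewrite !inner_cons2 addlast_rcons.
rewrite (_ : linext _ _ = linext (fun k => g r (k :: y)) (bas i * bas j) +
  sg (e (+) ((par i (+) par j) && (t (+) wpar r (+) wpar y)))
  * linext (fun k => rotsum e t g (rcons r k) y) (bas i * bas j)); last first.
  by rewrite -linext_fZ -linext_fD; apply: eq_linext => k /par_mul <-.
rewrite (_ : inner (fun w => rotsum e t g r (i :: w)) (j :: y) =
  inner (fun w => g r (i :: w)) (j :: y) +
  sg (e (+) (par i && (t (+) wpar r (+) wpar (j :: y))))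
  * inner (rotsum e t g (rcons r i)) (j :: y)); last first.
  by rewrite -innerZ -innerD; apply: eq_inner => w _ /= ->.
ring.
Qed.

(** The cyclic face of a partially rotated word. Before any rotation it is [wrap]; afterwards the
    first letter heads [r], and the same product is a [jump]. *)
Let tail_bdry e t g r y : int :=
  if r is _ :: _ then - sg (e (+) odd (size r)) * jump t (rotsum (~~ e) t g) r y
  else wrap (rotsum (~~ e) t g [::]) y.

Let tail_bdry_cons e t g r i y :
  tail_bdry e t g r (i :: y) = - sg (e (+) odd (size r)) * jump t g r (i :: y)
  + sg (e (+) (par i && (t (+) wpar r (+) wpar y))) * tail_bdry e t g (rcons r i) y.
Proof.
case: r => [|k r] /=.
  rewrite mulr0 add0r addbF mulrA; case: e; case: (par i); case: t;
  case: (wpar y); rewrite /= ?(expr0, expr1); ring.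
rewrite /jump addlast_rotsum /= size_rcons /=; sg_ring.
Qed.

(** The form of [rotsum_bdry] that the induction on [y] needs, with some letters already rotated.
    The extra terms are the faces inside [r] and across the border between [r] and [y]; they vanish
    for empty [r]. *)
Let rotsum_bdry_rec e t g r y :
  rotsum e t (rot_bdry e t g) r y =
  inner (rotsum (~~ e) t g r) y + tail_bdry e t g r y
  - sg (e (+) odd (size r)) * inner (fun r => rotsum (~~ e) t g r y) r
  + (if y is j :: y' then
       sg (par j && (t (+) wpar r (+) wpar y'))
       * addlast (fun r => rotsum (~~ e) t g r y') r j
     else 0).
Proof.
elim: y r => [|i y IH] r /=.
  rewrite inner_nil inner0 mulr0 subr0 addr0 add0r /tail_bdry.
  by case: r => //= j r; rewrite addlast_nil !mulr0.
rewrite IH {IH} inner_rotsum tail_bdry_cons inner_rcons.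
have -> : inner (fun r => g r (i :: y) + sg (~~ e (+) (par i &&
    (t (+) wpar r (+) wpar y))) * rotsum (~~ e) t g (rcons r i) y) r =
  inner (g^~ (i :: y)) r + sg (~~ e (+) (par i && (t (+) wpar r (+) wpar y)))
    * inner (fun r => rotsum (~~ e) t g (rcons r i) y) r.
  by rewrite -innerZ -innerD; apply: eq_inner => w _ ->.
rewrite /rot_bdry size_rcons sg_size.
case: y => [|j y]; rewrite /= ?wpar_rcons; sg_ring.
Qed.

(** Merging neighbours and then rotating gives the same words as rotating and then merging, where
    letters on either side of the border between rotated and remaining letters are never merged.
    Words one letter shorter rotate with the opposite sign, whence [~~ e]. *)
Lemma rotsum_bdry e t g y :
  rotsum e t (rot_bdry e t g) [::] y = dcyc (rotsum (~~ e) t g [::]) y.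
Proof.
rewrite rotsum_bdry_rec /= inner_nil mulr0 subr0.
by case: y => [|j y]; rewrite /= ?addlast_nil ?mulr0 addr0.
Qed.

End Rotations.

(** * Invariance and symmetry of the Casimir element *)

Section Casimir.
Variable A : frobeniusAlgebra.
Local Notation I := 'I_(rk A).
Local Notation par := (@par A).
Local Notation bas := (@bas A).
Local Notation pairing := (@pairing A).
Implicit Types (x y z : A) (i j k l : I) (s b : bool).

Lemma addf_pairingl y : addf (pairing^~ y).
Proof. by move=> x z; rewrite pairingDl. Qed.

Lemma addf_pairingr x : addf (pairing x).
Proof. by move=> y z; rewrite pairingDr. Qed.

Lemma addf_basis (V : zmodType) (f g : A -> V) :
  addf f -> addf g -> (forall k, f (bas k) = g (bas k)) -> f =1 g.
Proof.
move=> fD gD fg x; rewrite -(linext_addf x fD) -(linext_addf x gD).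
by apply: eq_linext.
Qed.

Lemma sign_mul b x : (-1) ^+ b * x = x *~ sg b.
Proof. by case: b; rewrite ?expr1 ?mulN1r ?mulrNz ?mul1r. Qed.

Lemma mulrz_int (a b : int) : a *~ b = a * b.
Proof. by rewrite -mulrzr intz. Qed.

Lemma addfZ (c : int) (f : A -> int) : addf f -> addf (fun x => c * f x).
Proof. by move=> fD x y; rewrite fD mulrDr. Qed.

Lemma pairing_swap x k : pairing x (bas k) = sg (par k) * pairing (bas k) x.
Proof.
apply: (addf_basis (f := pairing^~ (bas k))
  (g := fun x => sg (par k) * pairing (bas k) x)) => [||i].
- exact: addf_pairingl.
- by apply: addfZ; apply: addf_pairingr.
rewrite pairing_sym; have [->|/pairing_even ->] := eqVneq (pairing (bas k) (bas i)) 0.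
  by rewrite !mulr0.
by rewrite andbb.
Qed.

Lemma pairing_rot x y k :
  pairing x (y * bas k) = sg (par k) * pairing (bas k * x) y.
Proof. by rewrite pairing_assoc pairing_swap pairing_assoc. Qed.

Lemma addf_twist b : addf (twist b : A -> A).
Proof. exact: linextD. Qed.

Lemma twist_bas b k : twist b (bas k) = bas k *~ sg (b && par k).
Proof. by rewrite /twist linext_bas sign_mul. Qed.

Lemma twist_mull b k x : twist b (bas k * x) = (bas k * twist b x) *~ sg (b && par k).
Proof.
apply: (addf_basis (f := fun x => twist b (bas k * x))
  (g := fun x => (bas k * twist b x) *~ sg (b && par k))) => [y z|y z|i].
- by rewrite mulrDr addf_twist.
- by rewrite addf_twist mulrDr mulrzDl.
rewrite twist_bas mulrzAr -mulrzA sgM /twist.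
rewrite (linext_par (fun p j => (-1) ^+ (b && p) * bas j)).
rewrite -(linext_addf (bas k * bas i) (f := fun y => y *~ _)); last first.
  by move=> y z; rewrite mulrzDl.
by apply: eq_linext => j _; rewrite sign_mul -andb_addr addbC.
Qed.

Lemma twist_mulr b k x : twist b (x * bas k) = (twist b x * bas k) *~ sg (b && par k).
Proof.
apply: (addf_basis (f := fun x => twist b (x * bas k))
  (g := fun x => (twist b x * bas k) *~ sg (b && par k))) => [y z|y z|i].
- by rewrite mulrDl addf_twist.
- by rewrite addf_twist mulrDl mulrzDl.
rewrite twist_mull !twist_bas mulrzAr mulrzAl -!mulrzA.
by rewrite !sgM addbC.
Qed.

(** By symmetry of the pairing the middle factor of [comult 1] is the transposed Gram matrix, which
    cancels the first factor. *)
Lemma casimirE : casimir A = invmx (gram A).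
Proof.
have gU := gram_unit A; rewrite /casimir /comult.
rewrite (_ : \matrix_(k, l) _ = (gram A)^T).
  by rewrite mulVmx ?unitmx_tr // mul1mx.
by apply/matrixP => k l; rewrite !mxE pairing_assoc mul1r [RHS]pairing_sym andbC.
Qed.

Lemma casimir_sym i j : casimir A i j = sg (par j) * casimir A j i.
Proof.
pose P : 'M[int]_(rk A) := diag_mx (\row_k sg (par k)).
have gT : (gram A)^T = P *m gram A.
  by apply/matrixP => k l; rewrite mul_diag_mx !mxE pairing_swap.
have PP : P *m P = 1%:M.
  apply/matrixP => k l; rewrite mul_diag_mx !mxE.
  by case: eqP => [->|_]; rewrite ?mulr1n ?mulr0n ?mulr0 // -signr_addb addbb.
have PU : P \in unitmx by have [] := mulmx1_unit PP.
have gU := gram_unit A.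
have E : (casimir A)^T = casimir A *m P.
  rewrite casimirE trmx_inv gT.
  apply: (can_inj (mulKmx (_ : P *m gram A \in unitmx))).
    by rewrite unitmx_mul PU gU.
  rewrite mulmxV ?unitmx_mul ?PU ?gU //.
  by rewrite !mulmxA -[P *m _ *m _]mulmxA mulmxV // mulmx1 PP.
have ev := @casimir_even A; move: (casimir A) E ev => C /matrixP/(_ j i) E ev.
move: E; rewrite mul_mx_diag !mxE => ->; rewrite mulrC.
by have [->|/ev ->//] := eqVneq (C j i) 0; rewrite !mulr0.
Qed.

(** The reproducing property: the two legs form dual bases. *)
Lemma casimir_l (f : A -> int) x : addf f ->
  \sum_i \sum_j casimir A i j * (pairing x (bas i) * f (bas j)) = f x.
Proof.
move=> fD; rewrite exchange_big -(linext_addf x fD); apply: eq_bigr => j _ /=.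
rewrite mulrz_int.
under eq_bigr => i _ do rewrite mulrA.
rewrite -mulr_suml mulrC; congr (_ * _).
have -> : coord x 0 j = (coord x *m gram A *m casimir A) 0 j.
  by rewrite casimirE mulmxK ?gram_unit.
rewrite mxE; apply: eq_bigr => i _; rewrite mulrC; congr (_ * _).
rewrite -{1}[x]coordK pairing_linl mxE.
by apply: eq_bigr => k _; rewrite mxE.
Qed.

Lemma casimir_r (f : A -> int) x : addf f ->
  \sum_i \sum_j casimir A i j * (f (bas i) * pairing (bas j) x) = f x.
Proof.
move=> fD; rewrite -(linext_addf x fD); apply: eq_bigr => i _.
rewrite mulrz_int.
under eq_bigr => j _ do rewrite mulrCA.
rewrite -mulr_sumr; congr (_ * _).
have -> : coord x 0 i = (casimir A *m gram A *m (coord x)^T) i 0.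
  by rewrite casimirE mulVmx ?gram_unit // mul1mx mxE.
rewrite -mulmxA mxE; apply: eq_bigr => j _; congr (_ * _).
rewrite -{1}[x]coordK pairing_linr mxE.
by apply: eq_bigr => k _; rewrite !mxE mulrC.
Qed.

(** [cas s B] is the value of B on the Casimir element, with the Koszul sign of
    moving its second factor past something of parity s. *)
Definition cas s (B : A -> A -> int) : int :=
  \sum_i \sum_j casimir A i j * (sg (par j && s) * B (bas i) (bas j)).

Lemma eq_cas s B B' :
  (forall i j, par i = par j -> B (bas i) (bas j) = B' (bas i) (bas j)) ->
  cas s B = cas s B'.
Proof.
move=> BB; apply: eq_bigr => i _; apply: eq_bigr => j _.
have [->|/casimir_even ij] := eqVneq (casimir A i j) 0; first by rewrite !mul0r.
by rewrite BB.
Qed.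

Lemma casD s B B' : cas s (fun x y => B x y + B' x y) = cas s B + cas s B'.
Proof.
rewrite /cas -big_split; apply: eq_bigr => i _.
by rewrite -big_split; apply: eq_bigr => j _; rewrite !mulrDr.
Qed.

Lemma casZ s c B : cas s (fun x y => c * B x y) = c * cas s B.
Proof.
rewrite /cas mulr_sumr; apply: eq_bigr => i _.
by rewrite mulr_sumr; apply: eq_bigr => j _; ring.
Qed.

Lemma cas0 s : cas s (fun _ _ => 0) = 0.
Proof.
transitivity (0 * cas s (fun _ _ => 0)); last exact: mul0r.
by rewrite -casZ; apply: eq_cas => i j _; rewrite mul0r.
Qed.

Lemma cas_sum s (J : Type) (r : seq J) (B : J -> A -> A -> int) :
  cas s (fun x y => \sum_(m <- r) B m x y) = \sum_(m <- r) cas s (B m).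
Proof.
elim: r => [|m r IH].
  rewrite big_nil; transitivity (cas s (fun _ _ => 0)); last exact: cas0.
  by apply: eq_cas => i j _; rewrite big_nil.
by rewrite big_cons -IH -casD; apply: eq_cas => i j _; rewrite big_cons.
Qed.

Lemma cas_inner s (B : A -> A -> word A -> int) w :
  cas s (fun x y => inner (B x y) w) = inner (fun w => cas s (fun x y => B x y w)) w.
Proof.
rewrite inner_sum; apply: eq_bigr => i _.
by rewrite inner_sum; apply: eq_bigr => j _; rewrite !innerZ.
Qed.

Lemma cas_linext s (B : A -> A -> I -> int) z :
  cas s (fun x y => linext (B x y) z) = linext (fun k => cas s (fun x y => B x y k)) z.
Proof.
rewrite linext_fsum; apply: eq_bigr => i _.
by rewrite linext_fsum; apply: eq_bigr => j _; rewrite !linext_fZ.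
Qed.

Definition biaddf (B : A -> A -> int) :=
  (forall y, addf (B^~ y)) /\ (forall x, addf (B x)).

Lemma cas_twist s B : biaddf B -> cas s B = cas false (fun x y => B x (twist s y)).
Proof.
case=> _ BD; apply: eq_bigr => i _; apply: eq_bigr => j _; congr (_ * _).
by rewrite twist_bas (addf_sign (BD _)) mulrz_int andbF mul1r mulrC andbC.
Qed.

(** An operator on one leg passes to the other leg as its adjoint. Expanding [f] of the first leg in
    a second Casimir element, and likewise [g] of the second leg, gives the same double sum with the
    two elements exchanged; adjointness matches the pairings. *)
Lemma cas_adj B (f g : A -> A) : biaddf B -> addf f -> addf g ->
  (forall x y, pairing x (f y) = pairing (g x) y) ->
  cas false (fun x y => B (f x) y) = cas false (fun x y => B x (g y)).
Proof.
case=> B1 B2 fD gD fg; rewrite /cas.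
transitivity (\sum_i \sum_j \sum_k \sum_l casimir A i j * (casimir A k l *
    (B (bas k) (bas j) * pairing (bas l) (f (bas i))))).
  apply: eq_bigr => i _; apply: eq_bigr => j _.
  rewrite andbF mul1r -(casimir_r (f (bas i)) (B1 (bas j))) mulr_sumr.
  by apply: eq_bigr => k _; rewrite mulr_sumr.
transitivity (\sum_k \sum_l \sum_i \sum_j casimir A k l * (casimir A i j *
    (pairing (g (bas l)) (bas i) * B (bas k) (bas j)))); last first.
  apply: eq_bigr => k _; apply: eq_bigr => l _.
  rewrite andbF mul1r -(casimir_l (g (bas l)) (B2 (bas k))) mulr_sumr.
  by apply: eq_bigr => i _; rewrite mulr_sumr.
rewrite pair_big /=.
under eq_bigr => ij _ do rewrite pair_big /=.
rewrite [RHS]pair_big /=.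
under [RHS]eq_bigr => kl _ do rewrite pair_big /=.
rewrite exchange_big; apply: eq_bigr => kl _; apply: eq_bigr => ij _.
by rewrite fg; ring.
Qed.

(** Left multiplication is adjoint to right multiplication by associativity of the pairing. *)
Lemma cas_mull s B k : biaddf B ->
  cas s (fun x y => B (bas k * x) y) =
  sg (par k && s) * cas s (fun x y => B x (y * bas k)).
Proof.
move=> [B1 B2]; rewrite -casZ [RHS]cas_twist; last first.
  by split=> [y|x]; [apply: addfZ | move=> y z /=; rewrite mulrDl B2 mulrDr].
rewrite cas_twist; last by split=> [y x z|x] //=; rewrite mulrDr B1.
rewrite (cas_adj (B := fun x y => B x (twist s y)) (f := *%R (bas k))
  (g := *%R^~ (bas k))).
- apply: eq_cas => i j _; rewrite twist_mulr (addf_sign (B2 _)) mulrz_int mulrC.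
  by rewrite andbC.
- by split=> [y|x] // y z; rewrite addf_twist B2.
- exact: addf_mull.
- exact: addf_mulr.
- by move=> x y; rewrite pairing_assoc.
Qed.

(** This adjunction also uses the symmetry of the pairing and so holds only up to the parity of [k];
    this is the source of the negated [s]. *)
Lemma cas_mulr s B k : biaddf B ->
  cas s (fun x y => B (x * bas k) y) =
  sg (par k && ~~ s) * cas s (fun x y => B x (bas k * y)).
Proof.
move=> [B1 B2]; rewrite -casZ [RHS]cas_twist; last first.
  by split=> [y|x]; [apply: addfZ | move=> y z /=; rewrite mulrDr B2 mulrDr].
rewrite cas_twist; last by split=> [y x z|x] //=; rewrite mulrDl B1.
rewrite (cas_adj (B := fun x y => B x (twist s y)) (f := *%R^~ (bas k))
  (g := fun y => (bas k * y) *~ sg (par k))).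
- apply: eq_cas => i j _; rewrite (addf_sign (@addf_twist s)) twist_mull.
  rewrite !(addf_sign (B2 _)) !mulrz_int; sg_ring.
- by split=> [y|x] // y z; rewrite addf_twist B2.
- exact: addf_mulr.
- by move=> x y; rewrite mulrDr mulrzDl.
- move=> x y; rewrite pairing_rot (addf_sign (@addf_pairingl y)) mulrz_int.
  by rewrite mulrC.
Qed.

(** Exchanging two odd legs costs a sign, which negating [s] absorbs. *)
Lemma cas_swap s B : cas s B = cas (~~ s) (fun x y => B y x).
Proof.
rewrite /cas exchange_big; apply: eq_bigr => j _; apply: eq_bigr => i _.
rewrite casimir_sym; have [->|/casimir_even ->] := eqVneq (casimir A j i) 0.
  by rewrite mulr0 !mul0r.
sg_ring.
Qed.

End Casimir.

(** * Faces of a word with two inserted elements *)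

Section Insertion.
Variable A : frobeniusAlgebra.
Local Notation I := 'I_(rk A).
Local Notation word := (word A).
Local Notation par := (@par A).
Local Notation bas := (@bas A).
Implicit Types (x y z : A) (u v w r : word) (i j k l a b : I) (phi : word -> int).

Definition ins1 phi u x r : int := linext (fun k => phi (u ++ k :: r)) x.

Definition ins2 phi u x v y r : int :=
  linext (fun k => linext (fun m => phi (u ++ k :: v ++ m :: r)) y) x.

Lemma addf_ins1 phi u r : addf (fun x => ins1 phi u x r).
Proof. exact: linextD. Qed.

Lemma biaddf_ins2 phi u v r : biaddf (fun x y => ins2 phi u x v y r).
Proof.
split=> [y|x y z]; first exact: linextD.
by rewrite /ins2 -linext_fD; apply: eq_linext => k _; rewrite linextD.
Qed.

Lemma ins2_bas phi u k v m r :
  ins2 phi u (bas k) v (bas m) r = phi (u ++ k :: v ++ m :: r).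
Proof. by rewrite /ins2 !linext_bas. Qed.

Lemma ins2_basr phi u x v m r :
  ins2 phi u x v (bas m) r = linext (fun k => phi (u ++ k :: v ++ m :: r)) x.
Proof. by apply: eq_linext => k _; rewrite linext_bas. Qed.

Lemma ins2_basl phi u k v y r :
  ins2 phi u (bas k) v y r = linext (fun m => phi (u ++ k :: v ++ m :: r)) y.
Proof. by rewrite /ins2 linext_bas. Qed.

Lemma eq_onlast (V : zmodType) (g h : word -> I -> V) w :
  (forall w i, g w i = h w i) -> onlast g w = onlast h w.
Proof. by move=> gh; case/lastP: w => [|w i] //; rewrite !onlast_rcons. Qed.

Lemma addfD (f g : A -> int) : addf f -> addf g -> addf (fun x => f x + g x).
Proof. by move=> fD gD x y; rewrite fD gD addrACA. Qed.

Lemma addf_inner_fun (G : A -> word -> int) w :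
  (forall w, addf (G^~ w)) -> addf (fun x => inner (G x) w).
Proof. by move=> GD x y; rewrite -innerD; apply: eq_inner => w' _ _; rewrite GD. Qed.

Lemma addf_onlast (G : A -> word -> I -> int) w :
  (forall w i, addf (fun x => G x w i)) -> addf (fun x => onlast (G x) w).
Proof.
by move=> GD x y; case/lastP: w => [|w i]; rewrite ?addr0 // !onlast_rcons GD.
Qed.

Lemma addf_head (G : A -> I -> word -> int) w :
  (forall i w, addf (fun x => G x i w)) ->
  addf (fun x => if w is i :: w' then G x i w' else 0).
Proof. by move=> GD x y; case: w => [|i w]; rewrite ?addr0 ?GD. Qed.

(** Besides the faces inside [u], [v] and [r] there are the products of [x] and [y] with their
    neighbours. For empty [v] the two are neighbours of each other, which is the origin of the
    handle element. *)
Lemma ins2_inner phi u x v y r :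
  ins2 (inner phi) u x v y r =
  inner (fun u => ins2 phi u x v y r) u
  + (-1) ^+ size u *
    (onlast (fun u i => ins2 phi u (bas i * x) v y r) u
     - (if v is i :: v' then ins2 phi u (x * bas i) v' y r
        else ins1 phi u (x * y) r)
     - inner (fun v => ins2 phi u x v y r) v)
  - (-1) ^+ (size u + size v) *
    (onlast (fun v i => ins2 phi u x v (bas i * y) r) v
     - (if r is i :: r' then ins2 phi u x v (y * bas i) r' else 0)
     - inner (fun r => ins2 phi u x v y r) r).
Proof.
have I2l p q s t := (biaddf_ins2 p q s t).1.
have I2r p q s t := (biaddf_ins2 p q s t).2.
(* Differences are written with a factor -1, so that additivity follows from closure under sums and
   multiples. *)
pose R x y := inner (fun u => ins2 phi u x v y r) u
  + (-1) ^+ size u *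
    (onlast (fun u i => ins2 phi u (bas i * x) v y r) u
     + (- 1) * (if v is i :: v' then ins2 phi u (x * bas i) v' y r
        else ins1 phi u (x * y) r)
     + (- 1) * inner (fun v => ins2 phi u x v y r) v)
  + (- (-1) ^+ (size u + size v)) *
    (onlast (fun v i => ins2 phi u x v (bas i * y) r) v
     + (- 1) * (if r is i :: r' then ins2 phi u x v (y * bas i) r' else 0)
     + (- 1) * inner (fun r => ins2 phi u x v y r) r).
transitivity (R x y); last by rewrite /R; ring.
have R1 z : addf (R^~ z).
  apply: (addfD (addfD _ (addfZ _ (addfD (addfD _ (addfZ _ _)) (addfZ _ _))))
    (addfZ _ (addfD (addfD _ (addfZ _ _)) (addfZ _ _)))).
  - by apply: addf_inner_fun => w; apply: I2l.
  - by apply: addf_onlast => w i p q; rewrite mulrDr I2l.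
  - by case: (v) => [|i v'] p q; rewrite mulrDl ?I2l // addf_ins1.
  - by apply: addf_inner_fun => w; apply: I2l.
  - by apply: addf_onlast => w i; apply: I2l.
  - by apply: addf_head => i r'; apply: I2l.
  - by apply: addf_inner_fun => w; apply: I2l.
have R2 z : addf (fun y => R z y).
  apply: (addfD (addfD _ (addfZ _ (addfD (addfD _ (addfZ _ _)) (addfZ _ _))))
    (addfZ _ (addfD (addfD _ (addfZ _ _)) (addfZ _ _)))).
  - by apply: addf_inner_fun => w; apply: I2r.
  - by apply: addf_onlast => w i; apply: I2r.
  - by case: (v) => [|i v'] p q; rewrite ?mulrDr ?I2r // addf_ins1.
  - by apply: addf_inner_fun => w; apply: I2r.
  - by apply: addf_onlast => w i p q; rewrite mulrDr I2r.
  - by apply: addf_head => i r' p q; rewrite mulrDl I2r.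
  - by apply: addf_inner_fun => w; apply: I2r.
(* Both sides are biadditive, so basis letters suffice, and there [inner_cat] cuts the word
   twice. *)
apply: (addf_basis (f := fun x => ins2 (inner phi) u x v y r)
  (g := fun x => R x y)) => [p q|p q|k].
- exact: I2l.
- exact: R1.
apply: (addf_basis (f := fun y => ins2 (inner phi) u (bas k) v y r)
  (g := fun y => R (bas k) y)) => [p q|p q|m].
- exact: I2r.
- exact: R2.
rewrite ins2_bas /R inner_cat inner_cons.
rewrite (_ : junc _ _ _ = onlast (fun u i => ins2 phi u (bas i * bas k) v (bas m) r) u);
  last by apply: eq_onlast => w i; rewrite ins2_basr.
rewrite (_ : inner (fun w => phi (w ++ _)) u =
    inner (fun u => ins2 phi u (bas k) v (bas m) r) u); last first.
  by apply: eq_inner => w _ _; rewrite ins2_bas.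
rewrite (_ : (if v ++ m :: r is j :: w' then _ else 0) =
    if v is i :: v' then ins2 phi u (bas k * bas i) v' (bas m) r
    else ins1 phi u (bas k * bas m) r); last by case: (v) => // i v'; rewrite ins2_basr.
rewrite inner_cat inner_cons.
rewrite (_ : junc _ _ _ = onlast (fun v i => ins2 phi u (bas k) v (bas i * bas m) r) v);
  last by apply: eq_onlast => w i; rewrite ins2_basl.
rewrite (_ : inner (fun w => phi (u ++ k :: w ++ _)) v =
    inner (fun v => ins2 phi u (bas k) v (bas m) r) v); last first.
  by apply: eq_inner => w _ _; rewrite ins2_bas.
rewrite (_ : inner (fun w => phi (u ++ k :: v ++ m :: w)) r =
    inner (ins2 phi u (bas k) v (bas m)) r); last first.
  by apply: eq_inner => w _ _; rewrite ins2_bas.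
rewrite (_ : (if r is j :: w' then linext _ _ else 0) =
    if r is i :: r' then ins2 phi u (bas k) v (bas m * bas i) r' else 0); last first.
  by case: (r) => // i r'; rewrite ins2_basl.
by rewrite exprD; ring.
Qed.

End Insertion.

(** * Faces of the words of the coproduct *)

Section Product.
Variable A : frobeniusAlgebra.
Local Notation I := 'I_(rk A).
Local Notation word := (word A).
Local Notation par := (@par A).
Local Notation bas := (@bas A).
Implicit Types (x y z : A) (u v w r U V : word) (i j k l a b : I).
Implicit Types (phi : word -> int).

Definition prodf phi u a v b r : int :=
  sg (par b && wpar v) * cas (wpar v (+) par b)
    (fun x y => ins2 phi u (bas a * x * bas b) v y r).

(** The value of phi on the words u (a C' b) v C'' r, where U = ua and V = vb;
    the signs are the Koszul signs of moving a, b, C' and C'' into place. *)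
Definition psi phi U V r : int :=
  onlast (fun u a => onlast (fun v b => prodf phi u a v b r) V) U.

Lemma psi_rcons phi u a v b r : psi phi (rcons u a) (rcons v b) r = prodf phi u a v b r.
Proof. by rewrite /psi !onlast_rcons. Qed.

Definition defect phi U V r : int :=
  if V is [:: b] then
    onlast (fun u a => cas (par b)
      (fun x y => ins1 phi u (bas a * x * bas b * y) r)) U
  else 0.

Lemma linext_prodf_l phi u z v b r :
  linext (fun a => prodf phi u a v b r) z =
  sg (par b && wpar v) * cas (wpar v (+) par b)
    (fun x y => ins2 phi u (z * x * bas b) v y r).
Proof.
rewrite linext_fZ -cas_linext; congr (_ * _); apply: eq_cas => i j _.
rewrite -(linext_addf z (f := fun z => ins2 phi u (z * bas i * bas b) v (bas j) r)) //.
by move=> p q; rewrite !mulrDl (biaddf_ins2 _ _ _ _).1.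
Qed.

Lemma linext_prodf_r phi u a v b i r :
  linext (fun b => prodf phi u a v b r) (bas b * bas i) =
  sg ((par b (+) par i) && wpar v) * cas (wpar v (+) (par b (+) par i))
    (fun x y => ins2 phi u (bas a * x * (bas b * bas i)) v y r).
Proof.
rewrite (linext_par (fun p k => sg (p && wpar v) * cas (wpar v (+) p)
    (fun x y => ins2 phi u (bas a * x * bas k) v y r))).
rewrite linext_fZ -cas_linext; congr (_ * _); apply: eq_cas => m n _.
rewrite -(linext_addf (bas b * bas i)
  (f := fun z => ins2 phi u (bas a * bas m * z) v (bas n) r)) //.
by move=> p q; rewrite !mulrDr (biaddf_ins2 _ _ _ _).1.
Qed.

Lemma biaddf_ins2_mul phi u a b v r :
  biaddf (fun x y => ins2 phi u (bas a * x * bas b) v y r).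
Proof.
split=> [y p q|x]; last exact: (biaddf_ins2 _ _ _ _).2.
by rewrite mulrDr mulrDl (biaddf_ins2 _ _ _ _).1.
Qed.

Lemma cas_onlast s (B : A -> A -> word -> I -> int) w :
  cas s (fun x y => onlast (B x y) w) = onlast (fun w i => cas s (fun x y => B x y w i)) w.
Proof. by case/lastP: w => [|w i]; rewrite ?cas0 // onlast_rcons; apply: eq_cas => *; rewrite onlast_rcons. Qed.

(** Every product with a Casimir leg is a face of [U], a face of [V], or a jump. In front of
    [a C' b] a letter meets [a], behind it the letter forms the cyclic face of [V]. A letter in
    front of [C''] is carried to the right of [C'], next to [b]; one behind [C''] is carried to the
    left of [C'], next to [a]. What remains, for empty [v], is the product of both legs. *)
Lemma psi_inner phi u a v b r (U := rcons u a) (V := rcons v b) :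
  psi (inner phi) U V r =
  inner (fun U => psi phi U V r) U
  + (-1) ^+ size U * (dcyc (fun V => psi phi U V r) V + defect phi U V r)
  + (-1) ^+ (size U + size V) *
    (jump (wpar V) (fun r U => psi phi U V r) r U + inner (psi phi U V) r).
Proof.
rewrite psi_rcons /prodf.
pose s := wpar v (+) par b.
pose B phi u v r x y := ins2 phi u (bas a * x * bas b) v y r.
have BB phi' u' v' r' : biaddf (B phi' u' v' r') by exact: biaddf_ins2_mul.
pose S := sg (par b && wpar v).
have E1 : inner (fun U => psi phi U V r) U =
    S * inner (fun u => cas s (B phi u v r)) u
    + (-1) ^+ size u * (S * onlast (fun u i => cas s (fun x y =>
        ins2 phi u (bas i * (bas a * x * bas b)) v y r)) u).
  rewrite inner_rcons -innerZ; congr (_ + _ * _).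
    by apply: eq_inner => w _ _; rewrite psi_rcons.
  rewrite /addlast; case/lastP: (u) => [|w i]; rewrite ?mulr0 // !onlast_rcons.
  under eq_linext => k _ do rewrite psi_rcons.
  rewrite linext_prodf_l; congr (_ * _); apply: eq_cas => k l _.
  by rewrite !mulrA.
have E2 : inner (fun V => psi phi U V r) V =
    S * cas s (fun x y => inner (fun v => B phi u v r x y) v)
    + (-1) ^+ size v * (S * cas s (fun x y =>
        onlast (fun v i => B phi u v r x (bas i * y)) v)).
  rewrite inner_rcons cas_inner cas_onlast -innerZ; congr (_ + _ * _).
    by apply: eq_inner => w _ pw; rewrite psi_rcons /prodf pw.
  rewrite /addlast /S /s; case/lastP: (v) => [|w i]; rewrite ?mulr0 // !onlast_rcons.
  under eq_linext => k _ do rewrite psi_rcons.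
  rewrite linext_prodf_r wpar_rcons.
  rewrite (@eq_cas _ _ _ (fun x y => B phi u w r (x * bas i) y)); last first.
    by move=> m n _; rewrite /B !mulrA.
  rewrite (cas_mulr _ _ (BB phi u w r)); sg_ring.
have E3 : wrap (fun V => psi phi U V r) V =
    if v is i :: v' then
      S * cas s (fun x y => ins2 phi u (bas a * x * bas b * bas i) v' y r)
    else 0.
  rewrite /V /S /s; case: (v) => [|i w] /=; first by rewrite addlast_nil mulr0.
  rewrite addlast_rcons; under eq_linext => k _ do rewrite psi_rcons.
  rewrite linext_prodf_r wpar_rcons addbCA addbC.
  rewrite (@eq_cas _ _ _ (fun x y => ins2 phi u (bas a * x * bas b * bas i) w y r)).
    by rewrite -![par i (+) _]addbC addbA; sg_ring.
  by move=> m n _; rewrite !mulrA.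
have E4 : jump (wpar V) (fun r U => psi phi U V r) r U =
    if r is i :: r' then S * cas s (fun x y => B phi u v r' x (y * bas i)) else 0.
  rewrite /U /V /S /s /jump; case: (r) => // i w.
  rewrite addlast_rcons; under eq_linext => k _ do rewrite psi_rcons.
  rewrite linext_prodf_l wpar_rcons.
  rewrite (@eq_cas _ _ _ (fun x y => B phi u v w (bas i * x) y)); last first.
    by move=> m n _; rewrite /B !mulrA.
  rewrite (cas_mull _ _ (BB phi u v w)); sg_ring.
have E5 : inner (psi phi U V) r = S * cas s (fun x y => inner (fun r => B phi u v r x y) r).
  by rewrite cas_inner -innerZ; apply: eq_inner => w _ _; rewrite psi_rcons.
rewrite /dcyc E1 E2 E3 E4 E5 {E1 E2 E3 E4 E5} !size_rcons.
rewrite (@eq_cas _ _ _ (fun x y =>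
  inner (fun u => B phi u v r x y) u
  + (-1) ^+ size u *
    (onlast (fun u i => ins2 phi u (bas i * (bas a * x * bas b)) v y r) u
     + (-1) * (if v is i :: v' then ins2 phi u (bas a * x * bas b * bas i) v' y r
        else ins1 phi u (bas a * x * bas b * y) r)
     + (-1) * inner (fun v => B phi u v r x y) v)
  + (- (-1) ^+ (size u + size v)) *
    (onlast (fun v i => B phi u v r x (bas i * y)) v
     + (-1) * (if r is i :: r' then B phi u v r' x (y * bas i) else 0)
     + (-1) * inner (fun r => B phi u v r x y) r))); last first.
  by move=> i j _; rewrite ins2_inner /B; ring.
rewrite !(casD, casZ).
rewrite (_ : cas _ (fun x y => if v is _ :: _ then _ else _) =
    (if v is i :: v' then cas s (fun x y => ins2 phi u (bas a * x * bas b * bas i) v' y r)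
     else 0) + S * defect phi U V r); last first.
  rewrite /S /s /V /U /defect; case: (v) => [|i [|j w]] /=; last 2 first.
  - by rewrite mulr0 addr0.
  - by rewrite mulr0 addr0.
  - by rewrite onlast_rcons andbF mul1r add0r.
rewrite (_ : cas _ (fun x y => if r is _ :: _ then _ else _) =
    if r is i :: r' then cas s (fun x y => B phi u v r' x (y * bas i)) else 0); last first.
  by case: (r) => //; rewrite cas0.
rewrite [cas _ (fun x y => inner (fun u => B phi u v r x y) u)]cas_inner cas_onlast.
rewrite -/s -/S !addnS !addSn !exprS exprD !mulN1r opprK.
(* The defect has collected the square of [S], which [ring] cancels only for explicit signs. *)
have: S = 1 \/ S = -1 by rewrite /S; case: (_ && _); [right | left].
move: S => S' [] ->; case: (v) => [|? ?]; case: (r) => [|? ?]; ring.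
Qed.

End Product.

(** * Inserting the unit and rotating *)

Section CyclicRotation.
Variable A : frobeniusAlgebra.
Local Notation I := 'I_(rk A).
Local Notation word := (word A).
Local Notation par := (@par A).
Local Notation bas := (@bas A).
Implicit Types (x y z : A) (u v w r U V : word) (i j k l a b : I).
Implicit Types (phi : word -> int) (s t : bool).

Lemma inner_linext (g : word -> I -> int) w x :
  inner (fun w => linext (g w) x) w = linext (fun k => inner (g^~ k) w) x.
Proof.
rewrite inner_sum; apply: eq_bigr => k _.
by rewrite (addf_inner (f := fun n : int => n *~ _)) // => m n; rewrite mulrzDl.
Qed.

(** Insertion of the unit, as in Connes' operator. *)
Definition close1 phi w : int := linext (fun k => phi (rcons w k)) 1.

Definition rot phi w : int :=
  if w is i :: w' then sg (par i && wpar w') * phi (rcons w' i) else 0.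

(** The last letter absorbs the unit in the last inner face, the first letter absorbs it in the
    cyclic face; all other faces leave it in place. *)
Lemma close1_dcyc phi w : w != [::] ->
  close1 (dcyc phi) w = inner (close1 phi) w + (-1) ^+ size w * phi w + rot phi w.
Proof.
move=> w0; rewrite /close1 /dcyc linext_fD inner_linext -addrA.
rewrite (eq_linext (g := fun k => inner phi (rcons w k)) (h := fun k =>
  inner (fun w => phi (rcons w k)) w + (-1) ^+ size w * addlast phi w k)); last first.
  by move=> k _; rewrite inner_rcons.
rewrite linext_fD linext_fZ -addrA; congr (_ + (_ * _ + _)).
  case/lastP: w w0 => // w i _.
  under eq_linext => k _ do rewrite addlast_rcons.
  by rewrite (linext_comp _ _ (@addf_mull _ (bas i))) mulr1 linext_bas.
case: w w0 => //= i w _.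
under eq_linext => k _ do rewrite addlast_rcons wpar_rcons.
rewrite (linext_par1 (fun p k => sg (par i && (wpar w (+) p)) *
  linext (fun l => phi (rcons w l)) (bas k * bas i))) addbF linext_fZ.
by rewrite (linext_comp _ _ (@addf_mulr _ (bas i))) mul1r linext_bas.
Qed.

Lemma par_mul3 i j k l :
  coord (bas i * bas j * bas k) 0 l != 0 -> par l = par i (+) par j (+) par k.
Proof.
apply: contra_neq_eq => lP.
rewrite -(linext_addf (bas i * bas j) (f := fun x => coord (x * bas k) 0 l)).
  apply: big1 => m _.
  have [->|/par_mul pm] := eqVneq (coord (bas i * bas j) 0 m) 0; first by rewrite mulr0z.
  have [->|/par_mul pl] := eqVneq (coord (bas m * bas k) 0 l) 0; first by rewrite mul0rz.
  by move: lP; rewrite pl pm eqxx.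
by move=> x y; rewrite mulrDl coordD mxE.
Qed.

Lemma cas_reparam s s' B B' :
  (forall i j, par i = par j ->
     sg (par j && s) * B (bas i) (bas j) = sg (par j && s') * B' (bas i) (bas j)) ->
  cas s B = cas s' B'.
Proof.
move=> BB; apply: eq_bigr => i _; apply: eq_bigr => j _.
have [->|/casimir_even ij] := eqVneq (casimir A i j) 0; first by rewrite !mul0r.
by rewrite BB.
Qed.

Lemma eq_psi phi phi' U V r :
  (forall w, size w = (size U + size V + size r)%N -> phi w = phi' w) ->
  psi phi U V r = psi phi' U V r.
Proof.
case/lastP: U => [//|u a]; case/lastP: V => [|v b]; first by rewrite /psi !onlast_rcons.
move=> E; rewrite !psi_rcons; congr (_ * _); apply: eq_cas => i j _.
apply: eq_linext => k _; apply: eq_linext => m _; apply: E.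
by rewrite !size_rcons size_cat /= size_cat /= !addnS !addSn addnA.
Qed.

Lemma psiD phi phi' U V r :
  psi (fun w => phi w + phi' w) U V r = psi phi U V r + psi phi' U V r.
Proof.
case/lastP: U => [|u a]; first by rewrite addr0.
case/lastP: V => [|v b]; first by rewrite /psi !onlast_rcons addr0.
rewrite !psi_rcons /prodf -mulrDr -casD; congr (_ * _); apply: eq_cas => i j _.
by rewrite /ins2 -linext_fD; apply: eq_linext => k _; rewrite linext_fD.
Qed.

Lemma psiZ (c : int) phi U V r :
  psi (fun w => c * phi w) U V r = c * psi phi U V r.
Proof.
case/lastP: U => [|u a]; first by rewrite mulr0.
case/lastP: V => [|v b]; first by rewrite /psi !onlast_rcons mulr0.
rewrite !psi_rcons /prodf [RHS]mulrCA -(casZ _ c); congr (_ * _); apply: eq_cas => i j _.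
by rewrite /ins2 -linext_fZ; apply: eq_linext => k _; rewrite linext_fZ.
Qed.

Lemma psi_rot phi i U V r : U != [::] ->
  psi (rot phi) (i :: U) V r =
  sg (par i && (wpar U (+) wpar V (+) wpar r)) * psi phi U V (rcons r i).
Proof.
case/lastP: U => // u a _; rewrite -rcons_cons.
case/lastP: V => [|v b]; first by rewrite /psi !onlast_rcons mulr0.
rewrite !psi_rcons /prodf [RHS]mulrCA -(casZ _ (sg (par i && _))); congr (_ * _); apply: eq_cas => k l kl.
rewrite !ins2_basr -linext_fZ; apply: eq_linext => m /par_mul3 pm /=.
rewrite rcons_cat rcons_cons rcons_cat rcons_cons; congr (_ * _).
rewrite !(wpar_cat, wpar_rcons) /= wpar_cat /= pm kl; sg_ring.
Qed.

(** Here the letter moved to the end is the product [a C' b] itself. Carrying [a] and [b] over to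
    [C''] and exchanging the legs produces [b C' a], the product in the opposite coproduct. *)
Lemma psi_rot1 phi a V r : V != [::] ->
  psi (rot phi) [:: a] V r =
  sg (par a && (wpar V (+) wpar r)) * psi phi V (rcons r a) [::].
Proof.
case/lastP: V => // v b _; rewrite -[[:: a]]/(rcons [::] a) !psi_rcons /prodf.
pose B x y := ins2 phi v y r x [::].
have [B1 B2] : biaddf B by split=> y; [exact: (biaddf_ins2 _ _ _ _).2 | exact: (biaddf_ins2 _ _ _ _).1].
pose s := par a (+) true (+) wpar r.
pose c := sg ((par a && wpar v) (+) (par a && wpar r) (+) (par b && wpar r)
              (+) (par b && wpar v)).
rewrite (@cas_reparam _ s _ (fun x y => c * B (bas a * x * bas b) y)); last first.
  move=> i j ij; rewrite mulrA /B ins2_basl ins2_basr -!linext_fZ.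
  apply: eq_linext => k /par_mul3 pk /=; rewrite rcons_cat rcons_cons.
  rewrite !(wpar_cat, wpar_rcons) /= pk ij mulrA -cats1 /c /s; congr (_ * _); sg_ring.
rewrite casZ.
have -> : cas s (fun x y => B (bas a * x * bas b) y) =
    sg (par a && s) * cas s (fun x y => B (x * bas b) (y * bas a)).
  apply: (cas_mull s a (B := fun x y => B (x * bas b) y)).
  by split=> [y p q|x p q]; rewrite ?mulrDl ?B1 ?B2.
have -> : cas s (fun x y => B (x * bas b) (y * bas a)) =
    sg (par b && ~~ s) * cas s (fun x y => B x (bas b * y * bas a)).
  apply: (cas_mulr s b (B := fun x y => B x (y * bas a))).
  by split=> [y p q|x p q]; rewrite ?mulrDl ?B1 ?B2.
rewrite cas_swap (_ : ~~ s = wpar r (+) par a).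
  rewrite wpar_rcons /c /s /B; sg_ring.
by rewrite /s addbT addNb negbK addbC.
Qed.

End CyclicRotation.

(** * Cochains and bicochains as functionals *)

Section Evaluation.
Variable A : frobeniusAlgebra.
Local Notation I := 'I_(rk A).
Local Notation AA := 'M[int]_(rk A).
Local Notation word := (word A).
Local Notation par := (@par A).
Local Notation bas := (@bas A).
Local Notation pairing := (@pairing A).
Implicit Types (x y z : A) (u v w r U V : word) (i j k l a b : I).
Implicit Types (f : cochain A) (F : bicochain A) (T : AA) (s t : bool).

Definition cyc f : word -> int := onlast (fun w a => pairing (f w) (bas a)).

Lemma cyc_rcons f w a : cyc f (rcons w a) = pairing (f w) (bas a).
Proof. exact: onlast_rcons. Qed.

Lemma signn_mul (n : nat) x : (-1) ^+ n * x = x *~ (-1) ^+ n.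
Proof. by rewrite -signr_odd sign_mul signr_odd. Qed.

Lemma pairing_par2 i j k :
  pairing (bas i) (bas j * bas k) != 0 -> par i = par j (+) par k.
Proof.
apply: contra_neq_eq => iP; rewrite -(linext_addf _ (addf_pairingr (bas i))).
rewrite (eq_linext (h := fun _ => 0)) ?linext_f0 // => m /par_mul pm.
by apply/eqP; apply: contraNT iP => /pairing_even ->; rewrite pm.
Qed.

Lemma pairing_twist x i a :
  pairing (bas i * twist (par i) x) (bas a) =
  sg (par i && par a) * pairing x (bas a * bas i).
Proof.
apply: (addf_basis (f := fun x => pairing (bas i * twist (par i) x) (bas a))
  (g := fun x => sg (par i && par a) * pairing x (bas a * bas i))) => [p q|p q|k].
- by rewrite addf_twist mulrDr pairingDl.
- by rewrite pairingDl mulrDr.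
rewrite twist_bas mulrzAr (addf_sign (@addf_pairingl _ _)) mulrz_int pairing_rot.
set P := pairing (bas i * bas k) (bas a).
have [E|/pairing_par2 ->] := eqVneq (pairing (bas k) (bas a * bas i)) 0; last sg_ring.
have -> : P = 0 by rewrite -[P](signrMK (par i)) -pairing_rot E mulr0.
by rewrite mul0r !mulr0.
Qed.

Lemma linext_cyc f w x : linext (fun k => cyc f (rcons w k)) x = pairing (f w) x.
Proof.
rewrite -(linext_addf x (addf_pairingr (f w))).
by apply: eq_linext => k _; rewrite cyc_rcons.
Qed.

(** The left action in [hdiff] becomes the cyclic face, the right action the last inner face. *)
Lemma cyc_hdiff f w : cyc (hdiff f) w = dcyc (cyc f) w.
Proof.
case/lastP: w => [|w a]; first by rewrite /dcyc inner_nil addr0.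
rewrite cyc_rcons; case: w => [|i w].
  by rewrite dcyc1 (addf0 (@addf_pairingl _ _)).
rewrite /dcyc inner_rcons rcons_cons /= addlast_rcons linext_cyc.
rewrite /hdiff !pairingDl -[in LHS]addrA addrC; congr (_ + _); last first.
  rewrite sign_mul (addf_sign (@addf_pairingl _ _)) mulrz_int pairing_twist.
  rewrite wpar_rcons; sg_ring.
congr (_ + _).
  rewrite (addf_inner _ _ (@addf_pairingl _ _)); apply: eq_inner => w' _ _.
  by rewrite cyc_rcons.
rewrite addlast_cons linext_cyc signn_mul.
by rewrite (addf_sign (@addf_pairingl _ _)) mulrz_int mulrC pairing_assoc.
Qed.

(** The pairing of tensors without its Koszul sign, which is part of the sign in [hat]. *)
Definition tp T x y : int :=
  \sum_i \sum_j T i j * (pairing (bas i) x * pairing (bas j) y).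

Lemma addf_tp x y : addf (fun T => tp T x y).
Proof.
move=> T T'; rewrite /tp -big_split; apply: eq_bigr => i _.
by rewrite -big_split; apply: eq_bigr => j _ /=; rewrite mxE mulrDl.
Qed.

Lemma tpZ c T x y : tp (c *: T) x y = c * tp T x y.
Proof.
rewrite /tp mulr_sumr; apply: eq_bigr => i _.
by rewrite mulr_sumr; apply: eq_bigr => j _ /=; rewrite mxE -mulrA.
Qed.

Lemma biaddf_tp T : biaddf (tp T).
Proof.
split=> [y p q|x p q]; rewrite /tp -big_split; apply: eq_bigr => i _;
  rewrite -big_split; apply: eq_bigr => j _ /=; rewrite pairingDr; ring.
Qed.

Lemma tp_tens p q x y : tp (tens p q) x y = pairing p x * pairing q y.
Proof.
rewrite -{2}[p]coordK -{2}[q]coordK !pairing_linl big_distrl; apply: eq_bigr => i _.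
by rewrite /= mulr_sumr; apply: eq_bigr => j _; rewrite mxE; ring.
Qed.

Lemma tp_tmap al be T x y :
  tp (tmap al be T) x y =
  \sum_i \sum_j T i j * (pairing (al (bas i)) x * pairing (be (bas j)) y).
Proof.
rewrite (addf_sum (@addf_tp x y)); apply: eq_bigr => i _.
by rewrite (addf_sum (@addf_tp x y)); apply: eq_bigr => j _; rewrite tpZ tp_tens.
Qed.

Lemma tp_bas T k l : tp T (bas k) (bas l) = ((gram A)^T *m T *m gram A) k l.
Proof.
rewrite mxE /tp exchange_big; apply: eq_bigr => j _ /=.
rewrite !mxE mulr_suml; apply: eq_bigr => i _; rewrite !mxE; ring.
Qed.

Lemma tp_inj T T' : (forall k l, tp T (bas k) (bas l) = tp T' (bas k) (bas l)) -> T = T'.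
Proof.
have U : (gram A)^T \in unitmx by rewrite unitmx_tr gram_unit.
move=> E; apply: (can_inj (mulKmx U)); apply: (can_inj (mulmxK (gram_unit A))).
by apply/matrixP => k l; rewrite -!tp_bas.
Qed.

(** The sign moves [a] past [v] and past the second factor of the value, which has the parity of [b]
    wherever the pairing is nonzero. *)
Definition hat F U V : int :=
  onlast (fun u a => onlast (fun v b =>
    sg (par a && (wpar v (+) par b)) * tp (F u v) (bas a) (bas b)) V) U.

Lemma hat_rcons F u a v b : hat F (rcons u a) (rcons v b) =
  sg (par a && (wpar v (+) par b)) * tp (F u v) (bas a) (bas b).
Proof. by rewrite /hat !onlast_rcons. Qed.

(** Evaluating on basis elements multiplies a tensor by invertible Gram matrices, so identities of
    bicochains can be checked on functionals. *)
Lemma hat_inj F G u v :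
  (forall a b, hat F (rcons u a) (rcons v b) = hat G (rcons u a) (rcons v b)) ->
  F u v = G u v.
Proof.
move=> E; apply: tp_inj => a b; have := E a b; rewrite !hat_rcons.
by move/(congr1 (fun n => sg (par a && (wpar v (+) par b)) * n)); rewrite !signrMK.
Qed.

Lemma linext_hat_l F u v b i j :
  linext (fun a => hat F (rcons u a) (rcons v b)) (bas i * bas j) =
  sg ((par i (+) par j) && (wpar v (+) par b)) * tp (F u v) (bas i * bas j) (bas b).
Proof.
under eq_linext => k _ do rewrite hat_rcons.
rewrite (linext_par (fun p k => sg (p && _) * tp _ (bas k) _)) linext_fZ.
by rewrite (linext_addf _ ((biaddf_tp _).1 _)).
Qed.

Lemma linext_hat_r F u a v i j :
  linext (fun b => hat F (rcons u a) (rcons v b)) (bas i * bas j) =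
  sg (par a && (wpar v (+) (par i (+) par j))) * tp (F u v) (bas a) (bas i * bas j).
Proof.
under eq_linext => k _ do rewrite hat_rcons.
rewrite (linext_par (fun p k => sg (par a && (wpar v (+) p)) * tp _ _ (bas k))).
by rewrite linext_fZ (linext_addf _ ((biaddf_tp _).2 _)).
Qed.

Lemma pairing_twist0 s l b : pairing (twist s (bas l)) (bas b) =
  sg (s && par b) * pairing (bas l) (bas b).
Proof.
rewrite twist_bas (addf_sign (@addf_pairingl _ _)) mulrz_int mulrC.
by have [->|/pairing_even ->] := eqVneq (pairing (bas l) (bas b)) 0; rewrite ?mulr0.
Qed.

Lemma tp_tmap_mull T i a b :
  tp (tmap (fun x => bas i * twist (par i) x) (twist (par i)) T) (bas a) (bas b) =
  sg (par i && (par a (+) par b)) * tp T (bas a * bas i) (bas b).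
Proof.
rewrite tp_tmap /tp mulr_sumr; apply: eq_bigr => k _.
rewrite mulr_sumr; apply: eq_bigr => l _.
rewrite pairing_twist pairing_twist0; sg_ring.
Qed.

Lemma tp_tmap_mulr T i a b :
  tp (tmap (fun x => x * bas i) (twist (par i)) T) (bas a) (bas b) =
  sg (par i && par b) * tp T (bas i * bas a) (bas b).
Proof.
rewrite tp_tmap /tp mulr_sumr; apply: eq_bigr => k _.
rewrite mulr_sumr; apply: eq_bigr => l _.
rewrite pairing_twist0 -pairing_assoc; sg_ring.
Qed.

Lemma tp_tmap_id_mull T i x b :
  tp (tmap id (fun y => bas i * twist (par i) y) T) x (bas b) =
  sg (par i && par b) * tp T x (bas b * bas i).
Proof.
rewrite tp_tmap /tp mulr_sumr; apply: eq_bigr => k _.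
by rewrite mulr_sumr; apply: eq_bigr => l _; rewrite pairing_twist; ring.
Qed.

Lemma tp_tmap_id_mulr T i x y :
  tp (tmap id (fun y => y * bas i) T) x y = tp T x (bas i * y).
Proof.
rewrite tp_tmap; apply: eq_bigr => k _; apply: eq_bigr => l _.
by rewrite -pairing_assoc.
Qed.

Lemma hat_hdiff1 F U v b (V := rcons v b) :
  hat (hdiff1 F) U V = dcyc (fun U => hat F U V) U.
Proof.
rewrite /V; case/lastP: U => [|u a]; first by rewrite /dcyc inner_nil addr0.
rewrite hat_rcons; case: u => [|i u].
  by rewrite dcyc1 /hdiff1 (addf0 (@addf_tp _ _)) mulr0.
rewrite /dcyc inner_rcons rcons_cons /= addlast_rcons linext_hat_l.
rewrite addlast_cons linext_hat_l.
rewrite (eq_inner (h := fun u => sg (par a && (wpar v (+) par b)) *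
  tp (F u v) (bas a) (bas b))); last by move=> w _ _; rewrite hat_rcons.
rewrite innerZ /hdiff1 !addf_tp !tpZ (addf_inner _ _ (@addf_tp _ _)).
rewrite tp_tmap_mull tp_tmap_mulr exprD wpar_rcons.
rewrite ![(-1) ^+ (size u).+1]exprS sg_size; sg_ring.
Qed.

Lemma hat_hdiff2 F u a V (U := rcons u a) :
  hat (hdiff2 F) U V = dcyc (hat F U) V.
Proof.
rewrite /U; case/lastP: V => [|v b].
  by rewrite /dcyc inner_nil addr0 /hat onlast_rcons.
rewrite hat_rcons; case: v => [|i v].
  by rewrite dcyc1 /hdiff2 (addf0 (@addf_tp _ _)) mulr0.
rewrite /dcyc inner_rcons rcons_cons /= addlast_rcons linext_hat_r.
rewrite addlast_cons linext_hat_r.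
rewrite (eq_inner (h := fun w => sg (par a && (wpar (i :: v) (+) par b)) *
  tp (F u w) (bas a) (bas b))); last by move=> w _ pw; rewrite hat_rcons pw.
rewrite innerZ /hdiff2 !addf_tp !tpZ (addf_inner _ _ (@addf_tp _ _)).
rewrite tp_tmap_id_mull tp_tmap_id_mulr wpar_rcons.
rewrite ![(-1) ^+ (size v).+1]exprS sg_size.
have -> : wpar (belast i v) = par i (+) wpar v (+) par (last i v).
  by have /= -> := congr1 (@wpar A) (lastI i v); rewrite wpar_rcons addbK.
rewrite /=; sg_ring.
Qed.

End Evaluation.

(** * The coproduct as a functional *)

Section Coproduct.
Variable A : frobeniusAlgebra.
Local Notation I := 'I_(rk A).
Local Notation AA := 'M[int]_(rk A).
Local Notation word := (word A).
Local Notation par := (@par A).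
Local Notation bas := (@bas A).
Local Notation pairing := (@pairing A).
Implicit Types (x y z : A) (u v w r U V : word) (i j k l a b : I).
Implicit Types (f : cochain A) (F : bicochain A) (T : AA) (s t : bool).
Implicit Types (phi : word -> int).

Lemma hatD F G U V : hat (fun u v => F u v + G u v) U V = hat F U V + hat G U V.
Proof.
case/lastP: U => [|u a]; first by rewrite addr0.
case/lastP: V => [|v b]; first by rewrite /hat !onlast_rcons addr0.
by rewrite !hat_rcons addf_tp mulrDr.
Qed.

Lemma hatN F U V : hat (fun u v => - F u v) U V = - hat F U V.
Proof.
case/lastP: U => [|u a]; first by rewrite oppr0.
case/lastP: V => [|v b]; first by rewrite /hat !onlast_rcons oppr0.
by rewrite !hat_rcons (addfN (@addf_tp _ _ _)) mulrN.
Qed.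

Lemma hat_hdiff_tot F u a v b (U := rcons u a) (V := rcons v b) :
  hat (hdiff_tot F) U V =
  dcyc (fun U => hat F U V) U - (-1) ^+ size U * dcyc (hat F U) V.
Proof.
rewrite -hat_hdiff1 -hat_hdiff2 /U /V !hat_rcons /hdiff_tot addf_tp tpZ size_rcons.
by rewrite exprS; ring.
Qed.

Lemma hat_flip F u a v b (U := rcons u a) (V := rcons v b) :
  hat (flip F) U V =
  sg ((~~ odd (size U) && ~~ odd (size V)) (+) (wpar U && wpar V)) * hat F V U.
Proof.
rewrite /U /V !hat_rcons /flip tpZ -[(-1) ^+ (_ * _ + _)]signr_odd oddD oddM oddb !size_rcons /= !negbK.
rewrite (_ : tp (tswap _) _ _ = sg (par a && par b) * tp (F v u) (bas b) (bas a)).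
  by rewrite !wpar_rcons; sg_ring.
rewrite /tp mulr_sumr exchange_big; apply: eq_bigr => i _ /=.
rewrite mulr_sumr; apply: eq_bigr => j _; rewrite mxE.
have [->|/pairing_even ->] := eqVneq (pairing (bas j) (bas a)) 0; first by ring.
have [->|/pairing_even ->] := eqVneq (pairing (bas i) (bas b)) 0; ring.
Qed.

(** Pairing [C_2^(2)] with [b] collapses the second Casimir element and puts [b] in place of
    [C_2^(1)]. The factor [C_1^(1)] moves into the pairing with [a], and invariance carries [a] to
    the other leg, inside [f]. The leading sign reflects that [U] is one letter longer than [u]. *)
Lemma hat_DeltaCH f U V : hat (DeltaCH f) U V = - (-1) ^+ size U * psi (cyc f) U V [::].
Proof.
case/lastP: U => [|u a]; first by rewrite mulr0.
case/lastP: V => [|v b]; first by rewrite /psi /hat !onlast_rcons mulr0.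
rewrite hat_rcons psi_rcons size_rcons exprS mulN1r opprK /DeltaCH tpZ mulrCA.
congr (_ * _); rewrite /prodf.
pose ev x := linext (fun m => f (u ++ m :: v)) x.
have evD : addf ev by exact: linextD.
pose s := wpar v (+) par b.
rewrite (_ : cas _ _ = cas s (fun x y => pairing (ev (bas a * x * bas b)) y)); last first.
  apply: eq_cas => i j _; rewrite ins2_basr.
  rewrite /ev (addf_linext _ _ (@addf_pairingl _ (bas j))).
  by apply: eq_linext => k _; rewrite -cyc_rcons rcons_cat rcons_cons cats1.
pose B x y := pairing (ev (x * bas b)) y.
have BB : biaddf B.
  by split=> [y p q|x]; [rewrite /B mulrDl evD pairingDl | exact: addf_pairingr].
have E : cas s (fun x y => B x (y * bas a)) =
    sg (par a && s) * cas s (fun x y => pairing (ev (bas a * x * bas b)) y).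
  by rewrite -[LHS](signrMK (par a && s)) -(cas_mull s a BB).
rewrite -[RHS](signrMK (par a && s)).
rewrite [X in _ = _ * X]mulrCA -E; congr (_ * _).
(* In [DeltaCH] it is the second leg of the first Casimir element that stands inside [f], hence the
   exchange. *)
rewrite cas_swap /cas mulr_sumr (addf_sum (@addf_tp _ _ _)); apply: eq_bigr => i _.
rewrite mulr_sumr (addf_sum (@addf_tp _ _ _)); apply: eq_bigr => j _.
rewrite (addf_sum (@addf_tp _ _ _)).
have [C0|/casimir_even ij] := eqVneq (casimir A i j) 0.
  rewrite C0 mul0r mulr0; apply: big1 => k _.
  by rewrite (addf_sum (@addf_tp _ _ _)) big1 // => l _; rewrite tpZ !mul0r.
(* The reproducing property reintroduces the second Casimir element by expanding [b]. *)
rewrite /B -(casimir_r (f := fun x => pairing (ev (bas j * x)) (bas i * bas a))); last first.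
  by move=> p q; rewrite mulrDr evD pairingDl.
rewrite !mulr_sumr; apply: eq_bigr => k _.
rewrite (addf_sum (@addf_tp _ _ _)) !mulr_sumr; apply: eq_bigr => l _.
rewrite tpZ tp_tens -/(ev _) -pairing_assoc.
have [->|/casimir_even kl] := eqVneq (casimir A k l) 0; first by ring.
have [->|/pairing_even lb] := eqVneq (pairing (bas l) (bas b)) 0; first by ring.
by rewrite /s ij kl lb; sg_ring.
Qed.

End Coproduct.

(** * Handle elements and the symmetrized coproduct *)

Section Homotopy.
Variable A : frobeniusAlgebra.
Local Notation I := 'I_(rk A).
Local Notation AA := 'M[int]_(rk A).
Local Notation word := (word A).
Local Notation par := (@par A).
Local Notation bas := (@bas A).
Local Notation pairing := (@pairing A).
Implicit Types (x y z : A) (u v w r U V : word) (i j k l a b : I).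
Implicit Types (f : cochain A) (F : bicochain A) (T : AA) (s t : bool).
Implicit Types (phi : word -> int).

(** The handle operator z |-> C' z C''. *)
Definition handle z : A :=
  \sum_i \sum_j (bas i * twist (par j) z * bas j) *~ casimir A i j.

Lemma addf_handle : addf handle.
Proof.
move=> x y; rewrite /handle -big_split; apply: eq_bigr => i _ /=.
rewrite -big_split; apply: eq_bigr => j _ /=.
by rewrite addf_twist mulrDr mulrDl mulrzDl.
Qed.

Lemma cas_handle (L : A -> int) b : addf L ->
  cas (par b) (fun x y => L (x * bas b * y)) = L (handle (bas b)).
Proof.
move=> LD; rewrite /handle (addf_sum LD); apply: eq_bigr => i _.
rewrite (addf_sum LD); apply: eq_bigr => j _.
rewrite twist_bas mulrzAr mulrzAl !(addfMz LD) !mulrz_int; ring.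
Qed.

(** By invariance a letter to the left of [C'] may be carried to the right of [C'']; the sign comes
    from passing [b]. *)
Lemma handle_comm a b :
  bas a * handle (bas b) = (handle (bas b) * bas a) *~ sg (par a && par b).
Proof.
rewrite -[LHS]coordK -[RHS]coordK; apply: eq_bigr => k _; congr (_ *~ _).
pose L x := coord x 0 k.
have LD : addf L by move=> x y; rewrite /L coordD mxE.
rewrite -!/(L _) (addfMz LD) mulrz_int mulrC.
have La c : addf (fun x => L (c * x)) by move=> x y; rewrite mulrDr LD.
have Lb c : addf (fun x => L (x * c)) by move=> x y; rewrite mulrDl LD.
rewrite -(cas_handle b (La _)) -(cas_handle b (Lb _)).
pose B x y := L (x * bas b * y).
have BB : biaddf B by split=> [y p q|x p q]; rewrite /B ?mulrDr ?mulrDl LD.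
transitivity (cas (par b) (fun x y => B (bas a * x) y)).
  by apply: eq_cas => i j _; rewrite /B !mulrA.
rewrite (cas_mull _ _ BB); congr (_ * _).
by apply: eq_cas => i j _; rewrite /B !mulrA.
Qed.

Lemma defectE phi u a b r : defect phi (rcons u a) [:: b] r =
  ins1 phi u (bas a * handle (bas b)) r.
Proof.
rewrite /defect onlast_rcons.
rewrite -(cas_handle b (L := fun x => ins1 phi u (bas a * x) r)).
  by apply: eq_cas => i j _; rewrite !mulrA.
by move=> x y; rewrite mulrDr addf_ins1.
Qed.

(** The cyclic face multiplies [C''] by [i]; carried to the left of [C'], this [i] stands behind
    [a], which is the cyclic face of [U]. *)
Lemma psi_wrap phi i U V : U != [::] ->
  psi (wrap phi) (i :: U) V [::] = wrap (fun U => psi phi U V [::]) (i :: U).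
Proof.
case/lastP: U => // u a _; rewrite wrap_rcons -rcons_cons.
case/lastP: V => [|v b].
  rewrite /psi !onlast_rcons (eq_linext (h := fun _ => 0)).
    by rewrite linext_f0 mulr0.
  by move=> k _; rewrite onlast_rcons.
under eq_linext => k _ do rewrite psi_rcons.
rewrite linext_prodf_l psi_rcons /prodf.
pose s := wpar v (+) par b.
pose B x y := ins2 phi u (bas a * x * bas b) v y [::].
have BB : biaddf B by exact: biaddf_ins2_mul.
pose c := sg (par i && (wpar u (+) par a (+) par b (+) wpar v)).
rewrite (@eq_cas _ _ _ (fun x y => c * B x (y * bas i))); last first.
  move=> k l kl; rewrite /B ins2_basr /ins2 -linext_fZ.
  apply: eq_linext => m /par_mul3 pm.
  rewrite (_ : (i :: u) ++ m :: v ++ [:: l] = i :: rcons (u ++ m :: v) l); last first.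
    by rewrite rcons_cat rcons_cons cats1.
  rewrite wrap_rcons wpar_cat /= pm kl /c; congr (_ * _); first by sg_ring.
  by apply: eq_linext => n _; rewrite rcons_cat rcons_cons cats1.
rewrite casZ -[cas s (fun x y => B x (y * bas i))](signrMK (par i && s)) -(cas_mull _ _ BB).
rewrite (@eq_cas _ _ (fun x y => B (bas i * x) y)
  (fun x y => ins2 phi u (bas a * bas i * x * bas b) v y [::])); last first.
  by move=> k l _; rewrite /B !mulrA.
rewrite /s /c; sg_ring.
Qed.

(** When [U] is a single letter, the cyclic neighbour of [C''] is [a C' b], so the legs meet around
    [a]. *)
Lemma psi_wrap1 phi a v b :
  psi (wrap phi) [:: a] (rcons v b) [::] =
  sg (par a && wpar v) * ins1 phi v (handle (bas a) * bas b) [::].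
Proof.
rewrite -[[:: a]]/(rcons [::] a) psi_rcons /prodf.
pose B x y := ins1 phi v (x * bas a * y * bas b) [::].
rewrite (@cas_reparam _ _ (~~ par a) _ (fun x y =>
  sg ((par a && wpar v) (+) (par b && wpar v)) * B y x)); last first.
  move=> k l kl; rewrite /B ins2_basr /ins1 -(mulrA _ (bas a)) -(mulrA _ (bas a * _)).
  rewrite -(linext_comp _ (bas a * bas k * bas b) (@addf_mull _ (bas l))).
  rewrite -!linext_fZ; apply: eq_linext => m /par_mul3 pm.
  rewrite (_ : [::] ++ m :: v ++ [:: l] = m :: rcons v l); last by rewrite /= cats1.
  rewrite wrap_rcons pm kl mulrA [RHS]mulrA; congr (_ * _); first by sg_ring.
  by apply: eq_linext => n _; rewrite cats1.
rewrite casZ cas_swap negbK.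
rewrite -(cas_handle a (L := fun x => ins1 phi v (x * bas b) [::])); last first.
  by move=> x y; rewrite mulrDl addf_ins1.
sg_ring.
Qed.

Lemma dcyc_psi_size phi U V : dcyc (fun U => (-1) ^+ size U * psi phi U V [::]) U =
  - (-1) ^+ size U * dcyc (fun U => psi phi U V [::]) U.
Proof.
case: U => [|i U]; last by rewrite dcyc_size.
by rewrite /dcyc inner_nil !addr0 mulr0.
Qed.

(** All faces cancel except those in which the Casimir legs meet. Each of the two requires an output
    factor without arguments, so [DeltaCH] is a cohomology operation modulo [CH0]. *)
Lemma hat_comm1 f u a v b (U := rcons u a) (V := rcons v b) :
  hat (comm1 (@DeltaCH A) f) U V =
  (if u is [::] then sg (par a && wpar v) *
     ins1 (cyc f) v (handle (bas a) * bas b) [::] else 0)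
  - (if v is [::] then ins1 (cyc f) u (bas a * handle (bas b)) [::] else 0).
Proof.
have EU : dcyc (fun U => hat (DeltaCH f) U V) U =
    (-1) ^+ size U * dcyc (fun U => psi (cyc f) U V [::]) U.
  transitivity (dcyc (fun U => -1 * ((-1) ^+ size U * psi (cyc f) U V [::])) U).
    by apply: eq_dcyc => w _ _; rewrite hat_DeltaCH mulNr mulN1r.
  by rewrite dcycZ dcyc_psi_size; ring.
have EV : dcyc (hat (DeltaCH f) U) V =
    - (-1) ^+ size U * dcyc (fun V => psi (cyc f) U V [::]) V.
  by rewrite -dcycZ; apply: eq_dcyc => w _ _; rewrite hat_DeltaCH.
rewrite /comm1 hatD hat_hdiff_tot -/U -/V EU EV hat_DeltaCH.
rewrite (_ : psi _ U V [::] = psi (inner (cyc f)) U V [::] + psi (wrap (cyc f)) U V [::]);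
  last by rewrite -psiD; apply: eq_psi => w _; rewrite cyc_hdiff.
rewrite psi_inner -/U -/V inner_nil /jump addr0 mulr0 addr0.
have -> : defect (cyc f) U V [::] =
    if v is [::] then ins1 (cyc f) u (bas a * handle (bas b)) [::] else 0.
  by rewrite /V; case: (v) => [|i [|j w]] //; rewrite defectE.
have -> : psi (wrap (cyc f)) U V [::] = wrap (fun U => psi (cyc f) U V [::]) U +
    if u is [::] then sg (par a && wpar v) *
     ins1 (cyc f) v (handle (bas a) * bas b) [::] else 0.
  rewrite /U; case: (u) => [|i w]; last by rewrite rcons_cons psi_wrap ?addr0 //; case: (w).
  by rewrite psi_wrap1 /= addlast_nil mulr0 add0r.
rewrite {1}/dcyc {EU EV} /U size_rcons; case: (u) => [|i w]; first by rewrite expr1; ring.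
rewrite /= !exprS sg_size; sg_ring.
Qed.

Lemma hat_comm1E O f u a v b (U := rcons u a) (V := rcons v b) :
  hat (comm1 O f) U V =
  dcyc (fun U => hat (O f) U V) U - (-1) ^+ size U * dcyc (hat (O f) U) V
  + hat (O (hdiff f)) U V.
Proof. by rewrite /comm1 hatD hat_hdiff_tot. Qed.

Lemma hat_comm2E O f u a v b (U := rcons u a) (V := rcons v b) :
  hat (comm2 O f) U V =
  dcyc (fun U => hat (O f) U V) U - (-1) ^+ size U * dcyc (hat (O f) U) V
  - hat (O (hdiff f)) U V.
Proof. by rewrite /comm2 hatD hatN hat_hdiff_tot. Qed.

(** The signed interchange swaps the two partial differentials and is thus a chain map. *)
Lemma comm1_flip f u v : comm1 (@DeltaCH_op A) f u v = flip (comm1 (@DeltaCH A) f) u v.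
Proof.
apply: hat_inj => a b; rewrite hat_flip !hat_comm1E hat_flip.
pose U := rcons u a; pose V := rcons v b; rewrite -/U -/V.
pose c m n := sg ((~~ odd m && ~~ odd n) (+) (wpar U && wpar V)).
have flipE U' V' : hat (DeltaCH_op f) U' V' = sg ((~~ odd (size U') && ~~ odd (size V'))
    (+) (wpar U' && wpar V')) * hat (DeltaCH f) V' U'.
  case/lastP: U' => [|u' a']; last first.
    by case/lastP: V' => [|v' b']; rewrite ?hat_flip // /hat onlast_rcons mulr0.
  by case/lastP: V' => [|v' b']; rewrite /hat ?onlast_rcons mulr0.
have -> : dcyc (fun U => hat (DeltaCH_op f) U V) U =
    sg ((odd (size U) && ~~ odd (size V)) (+) (wpar U && wpar V))
    * dcyc (hat (DeltaCH f) V) U.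
  rewrite -dcycZ; apply: eq_dcyc => w sw pw; rewrite flipE pw sw.
  by rewrite /U /V !size_rcons /= ?negbK.
have -> : dcyc (hat (DeltaCH_op f) U) V =
    sg ((~~ odd (size U) && odd (size V)) (+) (wpar U && wpar V))
    * dcyc (fun V => hat (DeltaCH f) V U) V.
  rewrite -dcycZ; apply: eq_dcyc => w sw pw; rewrite flipE pw sw.
  by rewrite /U /V !size_rcons /= ?negbK.
rewrite !sg_size; sg_ring.
Qed.

Lemma comm1_sym f u v : comm1 (@Delta_sym A) f u v =
  comm1 (@DeltaCH A) f u v + comm1 (@DeltaCH_op A) f u v.
Proof.
apply: (hat_inj (G := fun u v => comm1 (@DeltaCH A) f u v +
  comm1 (@DeltaCH_op A) f u v)) => a b; rewrite hatD !hat_comm1E.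
have -> : dcyc (fun U => hat (Delta_sym f) U (rcons v b)) (rcons u a) =
    dcyc (fun U => hat (DeltaCH f) U (rcons v b) +
      hat (DeltaCH_op f) U (rcons v b)) (rcons u a).
  by apply: eq_dcyc => w _ _; rewrite -hatD.
have -> : dcyc (hat (Delta_sym f) (rcons u a)) (rcons v b) =
    dcyc (fun V => hat (DeltaCH f) (rcons u a) V +
      hat (DeltaCH_op f) (rcons u a) V) (rcons v b).
  by apply: eq_dcyc => w _ _; rewrite -hatD.
have -> : hat (Delta_sym (hdiff f)) (rcons u a) (rcons v b) =
    hat (DeltaCH (hdiff f)) (rcons u a) (rcons v b) +
    hat (DeltaCH_op (hdiff f)) (rcons u a) (rcons v b) by rewrite -hatD.
rewrite !dcycD; ring.
Qed.

(** The interchange matches the two handle terms, which cancel because handle elements are graded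
    central. *)
Lemma Delta_sym_well_defined : well_defined (@Delta_sym A).
Proof.
move=> f u v; rewrite comm1_sym comm1_flip.
pose F u v : AA := comm1 (@DeltaCH A) f u v + flip (comm1 (@DeltaCH A) f) u v.
apply: (hat_inj (F := F) (G := fun _ _ => 0)) => a b.
rewrite hatD hat_flip !hat_comm1 [RHS]hat_rcons (addf0 (@addf_tp _ _ _)) mulr0.
rewrite !handle_comm !(addf_sign (@addf_ins1 _ _ _ _)) !mulrz_int.
case: u => [|i u]; case: v => [|j v]; rewrite /= ?wpar_rcons; sg_ring.
Qed.

End Homotopy.

(** * Boundary of the homotopy *)

Section NullHomotopy.
Variable A : frobeniusAlgebra.
Local Notation I := 'I_(rk A).
Local Notation AA := 'M[int]_(rk A).
Local Notation word := (word A).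
Local Notation par := (@par A).
Local Notation bas := (@bas A).
Local Notation pairing := (@pairing A).
Implicit Types (x z : A) (u v w r y U V : word) (i j k l a b : I).
Implicit Types (f : cochain A) (F : bicochain A) (T : AA) (s t : bool).
Implicit Types (phi : word -> int).

(** The terms of two consecutive rotations cancel, up to the first and last. *)
Lemma rotsum_telescope phi V N r u a :
  (size r + size (rcons u a) + size V = N)%N -> V != [::] ->
  rotsum (~~ odd N) (wpar V)
    (fun r y => (-1) ^+ N * psi phi y V r + psi (rot phi) y V r) r (rcons u a) =
  (-1) ^+ N * psi phi (rcons u a) V r
  + sg ((~~ odd N && odd (size u))
        (+) (wpar u && ~~ (wpar V (+) wpar r (+) wpar u (+) par a))
        (+) (par a && (wpar V (+) wpar r (+) wpar u)))
    * psi phi V (rcons (r ++ u) a) [::].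
Proof.
move=> + V0; elim: u r => [|i u IH] r sN /=.
  rewrite mulr0 addr0 psi_rot1 // cats0; sg_ring.
rewrite IH; last by rewrite -sN size_rcons addSnnS.
rewrite psi_rot; last by case: (u).
rewrite cat_rcons -[(-1) ^+ N]signr_odd !(wpar_rcons, wpar_cat) /=.
sg_ring.
Qed.

(** The homotopy in functional form. The sign of a rotation is dictated by the cancellation in
    [rotsum_telescope]. *)
Definition rotprod phi U V : int :=
  (-1) ^+ size V * rotsum (~~ odd (size U + size V)) (wpar V)
    (fun r U => psi (close1 phi) U V r) [::] U.

(** By [close1_dcyc] each rotated word contributes its inner faces and two words in which the unit
    is absorbed. The former assemble through [psi_inner] and [rotsum_bdry] into the two
    differentials and the defects, the latter telescope. *)
Lemma rotprod_bdry phi u a v b (U := rcons u a) (V := rcons v b) :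
  dcyc (fun U => rotprod phi U V) U
  - (-1) ^+ size U * dcyc (rotprod phi U) V - rotprod (dcyc phi) U V =
  - (-1) ^+ size U * psi phi U V [::]
  - sg ((~~ odd (size U) && ~~ odd (size V)) (+) (wpar U && wpar V))
    * (-1) ^+ size V * psi phi V U [::]
  - (-1) ^+ (size U + size V) * rotsum (odd (size U + size V)) (wpar V)
      (fun r U => defect (close1 phi) U V r) [::] U.
Proof.
pose N := (size U + size V)%N; pose e := ~~ odd N; pose t := wpar V.
pose g V r y := psi (close1 phi) y V r.
have E : rotsum e t (fun r y => psi (close1 (dcyc phi)) y V r) [::] U =
  dcyc (rotsum (odd N) t (g V) [::]) U
  + (-1) ^+ size U * dcyc (fun V => rotsum (odd N) t (g V) [::] U) V
  + (-1) ^+ size U * rotsum (odd N) t (fun r y => defect (close1 phi) y V r) [::] U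
  + rotsum e t (fun r y => (-1) ^+ N * psi phi y V r + psi (rot phi) y V r) [::] U.
  rewrite -rotsum_dcyc -(negbK (odd N)) -/e -!rotsum_size -rotsum_bdry -!rotsumD.
  apply: eq_rotsum => r y sz _; case/lastP: y sz => // y k sz _.
  have {}sz : size U = (size r + size (rcons y k))%N by rewrite sz.
  rewrite (@eq_psi _ _ (fun w => inner (close1 phi) w + (-1) ^+ N * phi w + rot phi w)).
    rewrite !psiD psiZ psi_inner /rot_bdry.
    rewrite -/V (_ : (-1) ^+ (size (rcons y k) + size V) = - sg (e (+) odd (size r))).
      by rewrite /g /t; ring.
    rewrite -signr_odd /e /N sz !oddD -sgN; congr (sg _).
    by case: (odd _); case: (odd _); case: (odd _).
  move=> w sw; have sN : size w = N by rewrite sw /N sz addnC addnA.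
  by rewrite -sN close1_dcyc // -size_eq0 sw size_rcons.
(* Faces of [U] and [V] are one letter shorter, which flips the parity that governs the sign of a
   rotation. *)
have oN m n : (m.+1 + n)%N = N -> ~~ odd (m + n) = odd N by move=> <-.
have -> : dcyc (fun U => rotprod phi U V) U =
    (-1) ^+ size V * dcyc (rotsum (odd N) t (g V) [::]) U.
  rewrite -dcycZ; apply: eq_dcyc => w sw _; rewrite /rotprod oN //.
  by rewrite sw /N /U size_rcons.
have -> : dcyc (rotprod phi U) V =
    - (-1) ^+ size V * dcyc (fun V => rotsum (odd N) t (g V) [::] U) V.
  rewrite -dcycZ; apply: eq_dcyc => w sw pw; rewrite /rotprod addnC oN ?pw.
    by rewrite sw /V size_rcons exprS mulN1r opprK.
  by rewrite sw addnC /N /V size_rcons.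
rewrite {1}/rotprod -/N -/e -/t E /e /t rotsum_telescope //; last by rewrite /V; case: (v).
have oU : odd (size U) = ~~ odd (size u) by rewrite size_rcons.
have pU : wpar U = wpar u (+) par a by rewrite wpar_rcons.
rewrite cat0s -/U /N !exprD !sg_size oddD oU pU /=.
sg_ring.
Qed.

End NullHomotopy.

(** * Vanishing of the handle operator in positive degree *)

Section Gorenstein.
Variable A : frobeniusAlgebra.
Variable G : gorenstein A.
Local Notation I := 'I_(rk A).
Local Notation par := (@par A).
Local Notation bas := (@bas A).
Local Notation pairing := (@pairing A).
Local Notation d := (socle G).
Implicit Types (x y z : A) (i j k l a b : I).

Lemma gr_gt n x : (d < n)%N -> gr G n x = 0.
Proof.
move=> dn; rewrite -[x](gr_sum G) raddf_sum big1 // => i _.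
by rewrite gr_gr; case: eqP => // E; move: dn; rewrite E ltnNge -ltnS ltn_ord.
Qed.

Lemma gr_adj p x y : (p <= d)%N -> pairing x (gr G p y) = pairing (gr G (d - p) x) y.
Proof.
move=> pd; rewrite -{1}[x](gr_sum G) -{2}[y](gr_sum G).
rewrite (addf_sum (@addf_pairingl _ _)) (addf_sum (@addf_pairingr _ _)).
transitivity (pairing (gr G (d - p) x) (gr G p y)).
  have lt : (d - p < d.+1)%N by rewrite ltnS leq_subr.
  rewrite (bigD1 (Ordinal lt)) //= big1 ?addr0 // => i /eqP iP.
  apply: gr_pairing; apply/eqP => E; apply: iP; apply: val_inj => /=.
  by apply/eqP; rewrite -(eqn_add2r p) subnK // E.
have lt : (p < d.+1)%N by [].
rewrite (bigD1 (Ordinal lt)) //= big1 ?addr0 // => i /eqP iP.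
apply: gr_pairing; apply/eqP => E; apply: iP; apply: val_inj => /=.
by apply/eqP; rewrite -(eqn_add2l (d - p)) E subnK.
Qed.

Lemma addf_gr n : addf (gr G n).
Proof. by move=> x y; rewrite raddfD. Qed.

Lemma twist0 z : twist false z = z.
Proof.
rewrite -[RHS](linext_addf z (f := id)) //.
by apply: eq_linext => k _; rewrite /= mul1r.
Qed.

Lemma gr_twistb n s x : gr G n (twist s x) = twist s (gr G n x).
Proof.
by case: s; rewrite ?twist0 // gr_twist.
Qed.

(** The projections to degrees [p] and [d - p] are adjoint, so the Casimir legs have complementary
    degrees; a middle factor of positive degree pushes the product beyond the socle. *)
Lemma cas_mid_eq0 (L : A -> int) s w : addf L -> gr G 0 w = 0 ->
  cas s (fun x y => L (x * w * y)) = 0.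
Proof.
move=> LD w0.
rewrite cas_twist; last by split=> [y p q|x p q]; rewrite ?mulrDl ?mulrDr LD.
pose B p r q x y := L (gr G p x * gr G r w * twist s (gr G q y)).
have BB p r q : biaddf (B p r q).
  by split=> [y m n|x m n]; rewrite /B addf_gr ?addf_twist ?mulrDl ?mulrDr LD.
have B0 p r q : cas false (B p r q) = 0.
  have [pd|pd] := leqP p d; last first.
    rewrite -(cas0 A false); apply: eq_cas => i j _.
    by rewrite /B gr_gt // !mul0r (addf0 LD).
  case: r => [|r].
    rewrite -(cas0 A false); apply: eq_cas => i j _.
    by rewrite /B w0 mulr0 mul0r (addf0 LD).
  (* For complementary degrees the product has degree [d + r + 1]. Otherwise the projection on the
     first leg is carried to the second, where it meets a different one. *)
  have [E|E] := eqVneq q (d - p)%N.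
    rewrite -(cas0 A false); apply: eq_cas => i j _.
    rewrite /B -gr_twistb -gr_mul -gr_mul gr_gt ?(addf0 LD) //.
    by rewrite E addnS addSn addnAC subnKC // ltnS leq_addr.
  pose C x y := L (x * gr G r.+1 w * twist s (gr G q y)).
  transitivity (cas false (fun x y => C (gr G p x) y)); first by [].
  rewrite (cas_adj (B := C) (g := gr G (d - p)%N)).
  - rewrite -(cas0 A false); apply: eq_cas => i j _.
    rewrite /C gr_gr (negbTE E) (addf0 (@addf_twist _ s)) mulr0.
    exact: addf0 LD.
  - split=> [y m n|x m n]; first by rewrite /C !mulrDl LD.
    by rewrite /C addf_gr addf_twist mulrDr LD.
  - exact: addf_gr.
  - exact: addf_gr.
  - by move=> x y; rewrite gr_adj.
transitivity (cas false (fun x y => \sum_(p < d.+1) \sum_(r < d.+1)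
     \sum_(q < d.+1) B p r q x y)).
  apply: eq_cas => i j _; rewrite -{1}[bas i](gr_sum G) -{1}[w](gr_sum G).
  rewrite -{1}[bas j](gr_sum G).
  rewrite (addf_sum (@addf_twist _ s)).
  rewrite !big_distrl (addf_sum LD).
  apply: eq_bigr => p _; rewrite /= [X in X * _]big_distrr big_distrl (addf_sum LD).
  by apply: eq_bigr => r _; rewrite /= big_distrr (addf_sum LD).
rewrite cas_sum big1 // => p _; rewrite cas_sum big1 // => r _.
by rewrite cas_sum big1.
Qed.

Lemma twistK : involutive (twist true : A -> A).
Proof.
apply: (addf_basis (f := fun x => twist true (twist true x))) => [x y|x y|k] //.
  by rewrite !addf_twist.
by rewrite !twist_bas (addf_sign (@addf_twist A true)) twist_bas -mulrzA sgM addbb mulr1z.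
Qed.

Lemma coord_eq0 x : (forall k, coord x 0 k = 0) -> x = 0.
Proof. by move=> x0; rewrite -[x]coordK big1 // => k _; rewrite x0 mulr0z. Qed.

Lemma coord0 k : coord (0 : A) 0 k = 0.
Proof. by rewrite -(subrr 0) coordB subrr mxE. Qed.

(** On a single parity [s] the twists in [handle] reduce to the Koszul sign in [cas s]. *)
Let handle_homog_eq0 s w : gr G 0 w = 0 -> twist true w = w *~ sg s -> handle w = 0.
Proof.
move=> w0 tw; apply: coord_eq0 => k.
pose L x := coord x 0 k.
have LD : addf L by move=> x y; rewrite /L coordD mxE.
rewrite -/(L _) -(cas_mid_eq0 s LD w0) /handle (addf_sum LD).
apply: eq_bigr => i _; rewrite (addf_sum LD); apply: eq_bigr => j _.
have -> : twist (par j) w = w *~ sg (par j && s).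
  by case: (par j); rewrite ?tw // twist0 mulr1z.
by rewrite mulrzAr mulrzAl !(addfMz LD) !mulrz_int; ring.
Qed.

(** The sum and the difference of [z] and its twist are homogeneous for the parity. This gives the
    vanishing of twice the handle, and integer coordinates have no 2-torsion. *)
Lemma handle_eq0 z : gr G 0 z = 0 -> handle z = 0.
Proof.
move=> z0; pose z' := twist true z.
have z'0 : gr G 0 z' = 0 by rewrite gr_twist z0 (addf0 (@addf_twist A true)).
have E : handle z + handle z = 0.
  have -> : handle z + handle z = handle (z + z') + handle (z - z').
    by rewrite -!addf_handle addrACA subrr addr0.
  rewrite (@handle_homog_eq0 false) ?(@handle_homog_eq0 true) ?addr0 //.
  - by rewrite raddfB z0 z'0 subrr.
  - by rewrite addf_twist (addfN (@addf_twist A true)) twistK mulrN1z opprB addrC.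
  - by rewrite raddfD z0 z'0 addr0.
  - by rewrite addf_twist twistK mulr1z addrC.
apply: coord_eq0 => k.
have /eqP : coord (handle z + handle z) 0 k = 0 by rewrite E coord0.
by rewrite coordD mxE -mulr2n Num.Theory.mulrn_eq0 => /eqP.
Qed.

End Gorenstein.

(** * Annihilators and the kernel of the quotient *)

Section Kernels.
Variable A : frobeniusAlgebra.
Local Notation I := 'I_(rk A).
Local Notation AA := 'M[int]_(rk A).
Local Notation word := (word A).
Local Notation par := (@par A).
Local Notation bas := (@bas A).
Local Notation pairing := (@pairing A).
Implicit Types (x z : A) (u v w r y U V : word) (i j k l a b : I).
Implicit Types (f : cochain A) (F : bicochain A) (T : AA) (s t : bool).
Implicit Types (phi : word -> int) (N : A -> Prop).

(** The inverse of [hat]; since the pairing is perfect, any functional vanishing on empty words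
    comes from a bicochain. *)
Definition ofhat (g : word -> word -> int) : bicochain A := fun u v =>
  invmx (gram A)^T
    *m (\matrix_(a, b) (sg (par a && (wpar v (+) par b)) * g (rcons u a) (rcons v b)))
    *m invmx (gram A).

Lemma hat_ofhat g U V : (forall V, g [::] V = 0) -> (forall U, g U [::] = 0) ->
  hat (ofhat g) U V = g U V.
Proof.
move=> g1 g2; case/lastP: U => [|u a]; first by rewrite g1.
case/lastP: V => [|v b]; first by rewrite /hat onlast_rcons g2.
have U : (gram A)^T \in unitmx by rewrite unitmx_tr gram_unit.
rewrite hat_rcons tp_bas /ofhat !mulmxA mulmxV // mul1mx mulmxKV ?gram_unit //.
by rewrite mxE signrMK.
Qed.

Definition ann N : A -> Prop := fun x => forall z, N z -> pairing x z = 0.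

(** Each column of [T] gives a tensor of an element [c j] with a basis element. That [c j]
    annihilates [N] follows from the hypothesis because the Gram matrix is invertible. *)
Lemma tens_span_annl N T :
  (forall z b, N z -> tp T z (bas b) = 0) -> tens_span (ann N) (fun=> True) T.
Proof.
move=> TN; pose c j : A := \sum_i bas i *~ (\row_i T i j) 0 i.
exists [seq (c j, bas j) | j <- enum 'I_(rk A)]; split; last first.
  rewrite big_map big_enum; apply/matrixP => k l.
  rewrite summxE (bigD1 l) //= big1 => [|j jl].
    by rewrite !mxE basK mxE coord_bas eqxx mulr1 addr0.
  by rewrite !mxE coord_bas (negbTE jl) mulr0.
move=> _ /mapP [j _ ->]; split=> // z Nz /=.
suff E : (\row_j pairing (c j) z) = 0 by have /rowP/(_ j) := E; rewrite !mxE.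
apply: (can_inj (mulmxK (gram_unit A))); rewrite mul0mx; apply/rowP => b.
rewrite [RHS]mxE -(TN z b Nz) mxE /tp exchange_big; apply: eq_bigr => l _.
rewrite !mxE pairing_linl mulr_suml; apply: eq_bigr => i _.
by rewrite mxE; ring.
Qed.

Lemma tens_span_annr N T :
  (forall z a, N z -> tp T (bas a) z = 0) -> tens_span (fun=> True) (ann N) T.
Proof.
move=> TN; pose c i : A := \sum_j bas j *~ (\row_j T i j) 0 j.
exists [seq (bas i, c i) | i <- enum 'I_(rk A)]; split; last first.
  rewrite big_map big_enum; apply/matrixP => k l.
  rewrite summxE (bigD1 k) //= big1 => [|j jk].
    by rewrite !mxE basK mxE coord_bas eqxx mul1r addr0.
  by rewrite !mxE coord_bas (negbTE jk) mul0r.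
move=> _ /mapP [i _ ->]; split=> // z Nz /=.
suff E : (\row_i pairing (c i) z) = 0 by have /rowP/(_ i) := E; rewrite !mxE.
apply: (can_inj (mulmxK (gram_unit A))); rewrite mul0mx; apply/rowP => a.
rewrite [RHS]mxE -(TN z a Nz) mxE /tp; apply: eq_bigr => k _.
rewrite !mxE pairing_linl mulr_suml; apply: eq_bigr => j _.
by rewrite mxE; ring.
Qed.

Lemma zero_mod0 (K : A -> Prop) F : (forall u v, F u v = 0) -> zero_mod K F.
Proof.
move=> F0; exists (fun _ _ => 0), (fun _ _ => 0).
by split=> // [u v|v|u]; rewrite ?F0 ?addr0 //; exists [::]; rewrite big_nil.
Qed.

Lemma zero_mod_sub (K K' : A -> Prop) F :
  (forall x, K x -> K' x) -> zero_mod K F -> zero_mod K' F.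
Proof.
move=> KK [F1 [F2 [EF F10 F1K F20 F2K]]]; exists F1, F2; split=> // w.
  by have [s [sK E]] := F1K w; exists s; split=> // x /sK [] /KK.
by have [s [sK E]] := F2K w; exists s; split=> // x /sK [] ? /KK.
Qed.

Section Vanishing.
Variable N : A -> Prop.
Hypothesis N_twist : forall z, N z -> N (twist true z).
Hypothesis N_handle : forall z, N z -> handle z = 0.

Definition kills (g : I -> int) : Prop := forall z, N z -> linext g z = 0.

Lemma killsD g h : kills g -> kills h -> kills (fun k => g k + h k).
Proof. by move=> g0 h0 z Nz; rewrite linext_fD g0 ?h0 ?addr0. Qed.

Lemma killsZ c g : kills g -> kills (fun k => c * g k).
Proof. by move=> g0 z Nz; rewrite linext_fZ g0 ?mulr0. Qed.

(** The sign is absorbed by twisting [z]; this is where [N] has to be stable under the twist. *)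
Lemma kills_sign s g : kills g -> kills (fun k => sg (s && par k) * g k).
Proof.
move=> g0 z Nz; have Nsz : N (twist s z) by case: s; rewrite ?twist0 //; apply: N_twist.
rewrite -(g0 _ Nsz) -(linext_comp _ _ (@addf_twist A s)).
by apply: eq_linext => k _; rewrite twist_bas (addf_sign (@linextD A _ g)) linext_bas
  mulrz_int mulrC.
Qed.

Lemma kills_handle (L : A -> int) : addf L -> kills (fun k => L (handle (bas k))).
Proof.
move=> LD z Nz; rewrite (linext_addf _ (f := fun x => L (handle x))).
  by rewrite N_handle // (addf0 LD).
by move=> x y; rewrite addf_handle LD.
Qed.

Lemma eq_kills g h : g =1 h -> kills g -> kills h.
Proof. by move=> gh g0 z Nz; rewrite -(g0 z Nz); apply: eq_linext => k _; rewrite gh. Qed.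

Lemma kills_defect phi U r : kills (fun b => defect phi U [:: b] r).
Proof.
case/lastP: U => [|u a]; first by move=> z _; rewrite linext_f0.
apply: (eq_kills (g := fun b => ins1 phi u (bas a * handle (bas b)) r)).
  by move=> b; rewrite defectE.
apply: (kills_handle (L := fun x => ins1 phi u (bas a * x) r)).
by move=> x y; rewrite mulrDr addf_ins1.
Qed.

Lemma kills_rotsum e (g : I -> word -> word -> int) r y :
  (forall r y, kills (fun b => g b r y)) ->
  kills (fun b => rotsum e (par b) (g b) r y).
Proof.
move=> g0; elim: y r => [|i y IH] r /=; first by move=> z _; rewrite linext_f0.
apply: killsD => //.
apply: (eq_kills (g := fun b => sg (e (+) (par i && (wpar r (+) wpar y))) *
    (sg (par i && par b) * rotsum e (par b) (g b) (rcons r i) y))).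
  by move=> b /=; rewrite mulrA; congr (_ * _); sg_ring.
by apply: killsZ; apply: kills_sign.
Qed.

Lemma annr_of_hat F u :
  (forall a, kills (fun b => hat F (rcons u a) [:: b])) ->
  tens_span (fun=> True) (ann N) (F u [::]).
Proof.
move=> F0; apply: tens_span_annr => z a Nz.
rewrite -(linext_addf z ((biaddf_tp (F u [::])).2 (bas a))).
apply: (eq_kills _ (kills_sign (par a) (F0 a))) Nz => b.
by rewrite -[[:: b]]/(rcons [::] b) hat_rcons signrMK.
Qed.

Lemma annl_of_hat F v :
  (forall b, kills (fun a => hat F [:: a] (rcons v b))) ->
  tens_span (ann N) (fun=> True) (F [::] v).
Proof.
move=> F0; apply: tens_span_annl => z b Nz.
rewrite -(linext_addf z ((biaddf_tp (F [::] v)).1 (bas b))).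
apply: (eq_kills _ (kills_sign (wpar v (+) par b) (F0 b))) Nz => a.
by rewrite -[[:: a]]/(rcons [::] a) hat_rcons andbC signrMK.
Qed.

Lemma zero_mod_comm1 f : zero_mod (ann N) (comm1 (@DeltaCH A) f).
Proof.
(* If both words are empty, both handle terms occur, so a case distinction on the words cannot
   separate them. [F2] is the term for empty [v], and [F1] is the rest. *)
pose g U V := - defect (cyc f) U V [::].
pose F2 : bicochain A := ofhat g.
have hF2 U V : hat F2 U V = g U V.
  apply: hat_ofhat => [V'|U']; rewrite /g ?oppr0 //.
  by case: V' => [|b [|c V']]; rewrite /= ?oppr0.
pose F1 : bicochain A := fun u v => comm1 (@DeltaCH A) f u v - F2 u v.
exists F1, F2.
have hF u a v b : hat F1 (rcons u a) (rcons v b) =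
  if u is [::] then sg (par a && wpar v) *
     ins1 (cyc f) v (handle (bas a) * bas b) [::] else 0.
  rewrite hatD hatN hF2 hat_comm1 /g opprK; case: v => [|i [|j v]].
  - by rewrite defectE subrK.
  - by rewrite /= subr0 addr0.
  - by rewrite /= subr0 addr0.
split=> [u v|u v u0|v|u v v0|u].
- by rewrite /F1 subrK.
- apply: (hat_inj (F := F1) (G := fun _ _ => 0)) => a b.
  by rewrite hF [RHS]hat_rcons (addf0 (@addf_tp _ _ _)) mulr0; case: (u) u0.
- apply: annl_of_hat => b.
  apply: (eq_kills (g := fun a => sg (wpar v && par a) *
     ins1 (cyc f) v (handle (bas a) * bas b) [::])).
    by move=> a; rewrite -[[:: a]]/(rcons [::] a) hF andbC.
  apply: kills_sign; apply: (kills_handle (L := fun x => ins1 (cyc f) v (x * bas b) [::])).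
  by move=> x y; rewrite mulrDl addf_ins1.
- apply: (hat_inj (F := F2) (G := fun _ _ => 0)) => a b.
  rewrite hF2 [RHS]hat_rcons (addf0 (@addf_tp _ _ _)) mulr0 /g.
  by case: v v0 => [|i [|j v]]; rewrite //= oppr0.
- apply: annr_of_hat => a; apply: (eq_kills (g := fun b => (-1) *
    defect (cyc f) (rcons u a) [:: b] [::])); last by apply: killsZ; apply: kills_defect.
  by move=> b; rewrite hF2 mulN1r.
Qed.

End Vanishing.
End Kernels.

(** * The homotopy as an operation *)

Section Cocommutativity.
Variable A : frobeniusAlgebra.
Local Notation I := 'I_(rk A).
Local Notation AA := 'M[int]_(rk A).
Local Notation word := (word A).
Local Notation par := (@par A).
Local Notation bas := (@bas A).
Local Notation pairing := (@pairing A).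
Implicit Types (x z : A) (u v w r y U V : word) (i j k l a b : I).
Implicit Types (f : cochain A) (F : bicochain A) (T : AA) (s t e : bool).
Implicit Types (phi : word -> int) (N : A -> Prop).

Lemma rotsum0 e t (g : word -> word -> int) r y :
  (forall r y, g r y = 0) -> rotsum e t g r y = 0.
Proof.
by move=> g0; elim: y r => [//|i y IH] r /=; rewrite g0 IH mulr0 addr0.
Qed.

Lemma homotopy_exists : exists H : operation A,
  forall f U V, hat (H f) U V = rotprod (cyc f) U V.
Proof.
exists (fun f => ofhat (rotprod (cyc f))) => f U V.
apply: hat_ofhat => [V'|U']; first by rewrite /rotprod mulr0.
rewrite /rotprod rotsum0 ?mulr0 // => r y.
by rewrite /psi; case/lastP: y => // y a; rewrite onlast_rcons.
Qed.

Variable homotopy : operation A.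
Hypothesis hat_homotopy : forall f U V,
  hat (homotopy f) U V = rotprod (cyc f) U V.

Lemma eq_rotprod phi phi' U V :
  (forall w, size w = (size U + size V).+1 -> phi w = phi' w) ->
  rotprod phi U V = rotprod phi' U V.
Proof.
move=> E; congr (_ * _); apply: eq_rotsum => r y sz _ _; apply: eq_psi => w sw.
apply: eq_linext => k _; apply: E.
by rewrite size_rcons sw -[size U]sz addnC addnA.
Qed.

Lemma rotprodD phi phi' U V :
  rotprod (fun w => phi w + phi' w) U V = rotprod phi U V + rotprod phi' U V.
Proof.
rewrite /rotprod -mulrDr -rotsumD; congr (_ * _); apply: eq_rotsum => r y _ _ _.
by rewrite -psiD; apply: eq_psi => w _; rewrite /close1 linext_fD.
Qed.

Lemma cycD f g w : cyc (f \+ g) w = cyc f w + cyc g w.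
Proof.
by case/lastP: w => [|w i]; rewrite ?addr0 // !cyc_rcons pairingDl.
Qed.

Lemma homotopy_linear : linear_of_degree 2 homotopy.
Proof.
split=> [f g u v|n f g fg u v suv].
  apply: (hat_inj (G := fun u v => homotopy f u v + homotopy g u v)) => a b.
  rewrite hatD !hat_homotopy -rotprodD.
  by apply: eq_rotprod => w _; exact: cycD.
apply: hat_inj => a b; rewrite !hat_homotopy; apply: eq_rotprod => w.
case/lastP: w => // w i; rewrite !size_rcons !cyc_rcons => -[sw].
by rewrite fg // sw addnS addSn suv addn2.
Qed.

Lemma hat_homotopy_defect f u a v b (U := rcons u a) (V := rcons v b) :
  hat (fun u v => Delta_sym f u v - comm2 homotopy f u v) U V =
  (-1) ^+ (size U + size V) * rotsum (odd (size U + size V)) (wpar V)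
      (fun r U => defect (close1 (cyc f)) U V r) [::] U.
Proof.
rewrite hatD hatN hat_comm2E -/U -/V hatD hat_flip -/U -/V !hat_DeltaCH hat_homotopy.
have -> : dcyc (fun U => hat (homotopy f) U V) U = dcyc (fun U => rotprod (cyc f) U V) U.
  by apply: eq_dcyc => w _ _; rewrite hat_homotopy.
have -> : dcyc (hat (homotopy f) U) V = dcyc (rotprod (cyc f) U) V.
  by apply: eq_dcyc => w _ _; rewrite hat_homotopy.
rewrite (eq_rotprod (phi' := dcyc (cyc f))); last by move=> w _; exact: cyc_hdiff.
by rewrite rotprod_bdry -/U -/V; ring.
Qed.

Section Annihilator.
Variable N : A -> Prop.
Hypothesis N_twist : forall z, N z -> N (twist true z).
Hypothesis N_handle : forall z, N z -> handle z = 0.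

(** Defects occur only when [V] is a single letter, that is, in a second factor without arguments;
    the other summand of the kernel is taken to be zero. *)
Lemma homotopy_zero_mod f :
  zero_mod (ann N) (fun u v => Delta_sym f u v - comm2 homotopy f u v).
Proof.
exists (fun _ _ => 0), (fun u v => Delta_sym f u v - comm2 homotopy f u v).
split=> // [u v|v|u v v0|u].
- by rewrite add0r.
- by exists [::]; rewrite big_nil.
- apply: (hat_inj (F := fun u v => Delta_sym f u v - comm2 homotopy f u v)
    (G := fun _ _ => 0)) => a b.
  rewrite hat_homotopy_defect [RHS]hat_rcons (addf0 (@addf_tp _ _ _)) mulr0.
  by rewrite rotsum0 ?mulr0 // => r y; case: v v0 => [|i [|j v]].
- apply: (annr_of_hat (N := N) N_twist
    (F := fun u v => Delta_sym f u v - comm2 homotopy f u v)) => a.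
  apply: (eq_kills (g := fun b => (-1) ^+ ((size u).+1 + 1) *
      rotsum (odd ((size u).+1 + 1)) (par b)
      (fun r U => defect (close1 (cyc f)) U [:: b] r) [::] (rcons u a))).
    by move=> b; rewrite -[[:: b]]/(rcons [::] b) hat_homotopy_defect size_rcons /= addbF.
  apply: killsZ; apply: (kills_rotsum N_twist _
    (g := fun b r U => defect (close1 (cyc f)) U [:: b] r)) => r y.
  exact: kills_defect.
Qed.

End Annihilator.

(** * Compatibility with normalized cochains *)

Lemma linext_exch (g : I -> I -> int) x z :
  linext (fun k => linext (g k) z) x = linext (fun m => linext (g^~ m) x) z.
Proof.
rewrite [RHS]linext_fsum; apply: eq_bigr => k _.
by rewrite (addf_linext (f := fun n : int => n *~ _)) // => m n; rewrite mulrzDl.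
Qed.

Lemma normalized_cyc f u w i : normalized f ->
  linext (fun k => cyc f (u ++ k :: rcons w i)) 1 = 0.
Proof.
move=> nf; rewrite (eq_linext (h := fun k => pairing (f (u ++ k :: w)) (bas i))).
  by rewrite -(addf_linext _ _ (@addf_pairingl A (bas i))) nf (addf0 (@addf_pairingl A _)).
by move=> k _; rewrite -rcons_cons -rcons_cat cyc_rcons.
Qed.

(** The unit added by [close1] takes the coefficient slot, so every letter of the word, including
    the last, is an argument of [f]. *)
Lemma normalized_close1 f u w : normalized f ->
  linext (fun k => close1 (cyc f) (u ++ k :: w)) 1 = 0.
Proof.
move=> nf; rewrite linext_exch (eq_linext (h := fun _ => 0)) ?linext_f0 // => m _.
rewrite -[RHS](normalized_cyc u w m nf).
by apply: eq_linext => k _; rewrite rcons_cat rcons_cons.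
Qed.

(** The last letter is exempt, being a coefficient and not an argument. *)
Definition lin1_vanishes (g : word -> int) : Prop :=
  forall u w a, linext (fun k => g (u ++ k :: rcons w a)) 1 = 0.

Lemma ins2_vanishes (g : I -> word -> int) x z (u' v' r' : I -> word) :
  (forall m n, linext (fun k => g k (u' k ++ m :: v' k ++ n :: r' k)) 1 = 0) ->
  linext (fun k => ins2 (g k) (u' k) x (v' k) z (r' k)) 1 = 0.
Proof.
move=> g0; rewrite linext_exch (eq_linext (h := fun _ => 0)) ?linext_f0 // => m _.
by rewrite linext_exch (eq_linext (h := fun _ => 0)) ?linext_f0.
Qed.

Lemma psi_vanishes_l phi u w a V r : lin1_vanishes phi ->
  linext (fun k => psi phi (u ++ k :: rcons w a) V r) 1 = 0.
Proof.
move=> phi0; case/lastP: V => [|v b].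
  rewrite (eq_linext (h := fun _ => 0)) ?linext_f0 // => k _.
  by rewrite -rcons_cons -rcons_cat /psi onlast_rcons.
rewrite (eq_linext (h := fun k => prodf phi (u ++ k :: w) a v b r)); last first.
  by move=> k _; rewrite -rcons_cons -rcons_cat psi_rcons.
rewrite linext_fZ -cas_linext (@eq_cas _ _ _ (fun _ _ => 0)) ?cas0 ?mulr0 // => i j _.
apply: (@ins2_vanishes (fun=> phi) _ _ (fun k => u ++ k :: w)
  (fun=> v) (fun=> r)) => m n.
case/lastP: r => [|r c].
  rewrite -[RHS](phi0 u (w ++ m :: v) n); apply: eq_linext => k _.
  by rewrite -catA /= -cats1 -catA.
rewrite -[RHS](phi0 u (w ++ m :: v ++ n :: r) c); apply: eq_linext => k _.
by rewrite -catA /= rcons_cat rcons_cons rcons_cat rcons_cons.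
Qed.

Lemma psi_vanishes_r phi U u w b r : lin1_vanishes phi ->
  linext (fun k => psi phi U (u ++ k :: rcons w b) r) 1 = 0.
Proof.
move=> phi0; case/lastP: U => [|v a]; first by rewrite linext_f0.
rewrite (eq_linext (h := fun k => sg (par b && (wpar u (+) wpar w)) *
    cas (wpar u (+) wpar w (+) par b) (fun x z =>
      ins2 phi v (bas a * x * bas b) (u ++ k :: w) z r))); last first.
  move=> k /par_one pk; rewrite -rcons_cons -rcons_cat psi_rcons /prodf.
  by rewrite wpar_cat /= pk.
rewrite linext_fZ -cas_linext (@eq_cas _ _ _ (fun _ _ => 0)) ?cas0 ?mulr0 // => i j _.
apply: (@ins2_vanishes (fun=> phi) _ _ (fun=> v)
  (fun k => u ++ k :: w) (fun=> r)) => m n.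
case/lastP: r => [|r c].
  rewrite -[RHS](phi0 (v ++ m :: u) w n); apply: eq_linext => k _.
  by rewrite -!catA /= cats1.
rewrite -[RHS](phi0 (v ++ m :: u) (w ++ n :: r) c); apply: eq_linext => k _.
by rewrite -!catA /= rcons_cat rcons_cons.
Qed.

(** A unit in [r] may be the last letter of the whole word, hence the stronger hypothesis, which
    [close1] supplies. *)
Lemma psi_vanishes_m phi U V u w :
  (forall u w, linext (fun k => phi (u ++ k :: w)) 1 = 0) ->
  linext (fun k => psi phi U V (u ++ k :: w)) 1 = 0.
Proof.
move=> phi0; case/lastP: U => [|v a]; first by rewrite linext_f0.
case/lastP: V => [|v' b].
  rewrite (eq_linext (h := fun _ => 0)) ?linext_f0 // => k _.
  by rewrite /psi onlast_rcons.
rewrite (eq_linext (h := fun k => prodf phi v a v' b (u ++ k :: w))); last first.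
  by move=> k _; rewrite psi_rcons.
rewrite linext_fZ -cas_linext (@eq_cas _ _ _ (fun _ _ => 0)) ?cas0 ?mulr0 // => i j _.
apply: (@ins2_vanishes (fun=> phi) _ _ (fun=> v)
  (fun=> v') (fun k => u ++ k :: w)) => m n.
rewrite -[RHS](phi0 (v ++ m :: v' ++ n :: u) w); apply: eq_linext => k _.
by rewrite -!catA /= -!catA.
Qed.

Lemma rotsum_vanishes_r e t g r y w : (forall r w y, linext (fun k => g (r ++ k :: w) y) 1 = 0) ->
  linext (fun k => rotsum e t g (r ++ k :: w) y) 1 = 0.
Proof.
move=> g0; elim: y w => [|i y IH] w /=; first by rewrite linext_f0.
rewrite linext_fD g0 add0r (eq_linext (h := fun k =>
  sg (e (+) (par i && (t (+) (wpar r (+) wpar w) (+) wpar y))) *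
  rotsum e t g (r ++ k :: rcons w i) y)); first by rewrite linext_fZ IH mulr0.
by move=> k /par_one pk; rewrite wpar_cat /= pk rcons_cat rcons_cons.
Qed.

(** The unit stays in the remaining letters until it is rotated into [r], so vanishing is required
    in both places. *)
Lemma rotsum_vanishes_l e t g r u w a :
  (forall r w y, linext (fun k => g (r ++ k :: w) y) 1 = 0) ->
  (forall r, lin1_vanishes (g r)) ->
  linext (fun k => rotsum e t g r (u ++ k :: rcons w a)) 1 = 0.
Proof.
move=> g0 g1; elim: u r => [|i u IH] r /=.
  rewrite linext_fD (g1 r [::] w a) add0r (eq_linext (h := fun k => sg e *
    rotsum e t g (r ++ k :: [::]) (rcons w a))).
    by rewrite linext_fZ rotsum_vanishes_r // mulr0.
  by move=> k /par_one pk; rewrite pk cats1 addbF.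
rewrite linext_fD (g1 r (i :: u) w a) add0r (eq_linext (h := fun k =>
  sg (e (+) (par i && (t (+) wpar r (+) (wpar u (+) wpar (rcons w a))))) *
  rotsum e t g (rcons r i) (u ++ k :: rcons w a))); first by rewrite linext_fZ IH mulr0.
by move=> k /par_one pk; rewrite wpar_cat /= pk.
Qed.

Lemma rotsum_vanishes e t (g : I -> word -> word -> int) r y :
  (forall r y, linext (fun k => g k r y) 1 = 0) ->
  linext (fun k => rotsum e t (g k) r y) 1 = 0.
Proof.
move=> g0; elim: y r => [|i y IH] r /=; first by rewrite linext_f0.
by rewrite linext_fD g0 add0r linext_fZ IH mulr0.
Qed.

Lemma binormalized_hat F :
  (forall u w a V, linext (fun k => hat F (u ++ k :: rcons w a) V) 1 = 0) ->
  (forall U u w b, linext (fun k => hat F U (u ++ k :: rcons w b)) 1 = 0) ->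
  binormalized F.
Proof.
move=> F1 F2; split=> [u u' v|u v v']; apply: tp_inj => a b;
  rewrite (addf_linext _ _ (@addf_tp A _ _)) [RHS](addf0 (@addf_tp A _ _)).
  rewrite (eq_linext (h := fun k => sg (par a && (wpar v (+) par b)) *
    hat F (u ++ k :: rcons u' a) (rcons v b))); first by rewrite linext_fZ F1 mulr0.
  by move=> k _; rewrite -rcons_cons -rcons_cat hat_rcons signrMK.
rewrite (eq_linext (h := fun k => sg (par a && (wpar v (+) wpar v' (+) par b)) *
    hat F (rcons u a) (v ++ k :: rcons v' b))); first by rewrite linext_fZ F2 mulr0.
move=> k /par_one pk; rewrite -rcons_cons -rcons_cat hat_rcons.
by rewrite wpar_cat /= pk signrMK.
Qed.

Lemma DeltaCH_descends (K : A -> Prop) : descends K (@DeltaCH A).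
Proof.
split=> [f nf|f [_ f0]].
  have nc : lin1_vanishes (cyc f) by move=> u w a; exact: normalized_cyc.
  apply: binormalized_hat => [u w a V|U u w b].
    rewrite (eq_linext (h := fun k => - (-1) ^+ (size u + (size w).+2) *
      psi (cyc f) (u ++ k :: rcons w a) V [::])); first by rewrite linext_fZ psi_vanishes_l // mulr0.
    by move=> k _; rewrite hat_DeltaCH size_cat /= size_rcons.
  rewrite (eq_linext (h := fun k => - (-1) ^+ size U *
      psi (cyc f) U (u ++ k :: rcons w b) [::])); last by move=> k _; rewrite hat_DeltaCH.
  by rewrite linext_fZ psi_vanishes_r // mulr0.
apply: zero_mod0 => u v; apply: (hat_inj (G := fun _ _ => 0)) => a b.
rewrite hat_DeltaCH [RHS]hat_rcons (addf0 (@addf_tp A _ _)) mulr0.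
(* The words in [psi] have at least two letters here, so a cochain supported on the empty word
   contributes nothing. *)
rewrite (@eq_psi _ _ (fun w => 0 * cyc f w)) ?psiZ ?mul0r ?mulr0 // => w.
case/lastP: w => [//|[|j w] i]; first by rewrite !size_rcons addn0 addnS.
by move=> _; rewrite cyc_rcons f0 // (addf0 (@addf_pairingl A _)) mul0r.
Qed.

Lemma homotopy_descends (K : A -> Prop) : descends K homotopy.
Proof.
split=> [f nf|f [_ f0]].
  have nc u w : linext (fun k => close1 (cyc f) (u ++ k :: w)) 1 = 0.
    exact: normalized_close1.
  have nc1 : lin1_vanishes (close1 (cyc f)) by move=> u w a; exact: nc.
  apply: binormalized_hat => [u w a V|U u w b].
    rewrite (eq_linext (h := fun k => (-1) ^+ size V *
      rotsum (~~ odd (size u + (size w).+2 + size V)) (wpar V)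
        (fun r U => psi (close1 (cyc f)) U V r) [::] (u ++ k :: rcons w a))); last first.
      by move=> k _; rewrite hat_homotopy /rotprod size_cat /= size_rcons.
    rewrite linext_fZ rotsum_vanishes_l ?mulr0 // => [r w' y|r u' w' a'].
      exact: psi_vanishes_m.
    exact: psi_vanishes_l.
  rewrite (eq_linext (h := fun k => (-1) ^+ (size u + (size w).+2) *
    rotsum (~~ odd (size U + (size u + (size w).+2))) (wpar u (+) wpar (rcons w b))
      (fun r U => psi (close1 (cyc f)) U (u ++ k :: rcons w b) r) [::] U)); last first.
    move=> k /par_one pk; rewrite hat_homotopy /rotprod size_cat /= size_rcons.
    by rewrite wpar_cat /= pk.
  rewrite linext_fZ (rotsum_vanishes _ _
    (g := fun k r U => psi (close1 (cyc f)) U (u ++ k :: rcons w b) r)) ?mulr0 // => r y.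
  exact: psi_vanishes_r.
apply: zero_mod0 => u v; apply: (hat_inj (G := fun _ _ => 0)) => a b.
rewrite hat_homotopy [RHS]hat_rcons (addf0 (@addf_tp A _ _)) mulr0.
rewrite (eq_rotprod (phi' := cyc (fun _ : word => 0 : A))).
  rewrite /rotprod rotsum0 ?mulr0 // => r y.
  rewrite (@eq_psi _ _ (fun w => 0 * cyc f w)) ?psiZ ?mul0r // => w _.
  rewrite mul0r /close1 (eq_linext (h := fun _ => 0)) ?linext_f0 // => k _.
  by rewrite cyc_rcons (addf0 (@addf_pairingl A _)).
case/lastP => [//|[|j w] i]; first by rewrite !size_rcons addnS.
by move=> _; rewrite !cyc_rcons f0.
Qed.

End Cocommutativity.

Theorem proposition2p7 (A : frobeniusAlgebra) :
  [/\ well_defined (@Delta_sym A),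
      null_homotopic_mod (@CH0 A) (@Delta_sym A),
      (forall G : gorenstein A,
         null_homotopic_mod (constants G) (@Delta_sym A)),
      cocommutative_mod (@CH0 A)
    & forall G : gorenstein A, cocommutative_reduced G].
Proof.
have [H hatH] := homotopy_exists A.
(* The annihilator of zero is everything, so [N0] handles the quotient by [CH0]. *)
pose N0 (z : A) : Prop := z = 0.
have N0t z : N0 z -> N0 (twist true z) by move=> ->; rewrite /N0 (addf0 (@addf_twist A _)).
have N0h z : N0 z -> handle z = 0 by move=> ->; exact: addf0 (@addf_handle A).
have annN0 x : ann N0 x -> CH0 x by [].
have GNt (G : gorenstein A) z : gr G 0 z = 0 -> gr G 0 (twist true z) = 0.
  by move=> z0; rewrite gr_twist z0 (addf0 (@addf_twist A _)).
have null0 : null_homotopic_mod (@CH0 A) (@Delta_sym A).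
  exists H; split; first exact: homotopy_linear hatH.
  by move=> f; apply: (zero_mod_sub annN0); exact: (homotopy_zero_mod hatH).
split=> //.
- exact: Delta_sym_well_defined.
- move=> G; exists H; split; first exact: homotopy_linear hatH.
  by move=> f; apply: (homotopy_zero_mod hatH); [exact: GNt | exact: handle_eq0].
- split=> // f; apply: (zero_mod_sub annN0); exact: zero_mod_comm1.
- move=> G; split.
  + exact: DeltaCH_descends.
  + by move=> f _; apply: zero_mod_comm1; [exact: GNt | exact: handle_eq0].
  + exists H; split; first exact: homotopy_linear hatH.
      exact: homotopy_descends hatH _.
    by move=> f _; apply: (homotopy_zero_mod hatH); [exact: GNt | exact: handle_eq0].
Qed.
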